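(* Let $n\ge 1$. (1) The map which sends a necklace $(M_1,\ldots,M_n)$ of order $n$ to the sequence $$(\Pi_0(M_1,M_1),\Pi_0(M_1,M_2),\ldots,\Pi_0(M_1,M_n))$$ is a bijection between the set of necklaces of order $n$ and the set of maximal chains of $2$-divisible noncrossing partitions on $\langle 0,2n-1\rangle$. (2) Every necklace (of order $n$) is a strong necklace.
   Context: **Matchings and partitions.** $\langle 0,2n-1\rangle=\{0,1,\ldots,2n-1\}$. A matching on a set of size $2n$ is a partition of it into $n$ subsets of size $2$ (pairs). Two blocks of a partition of a subset of $\mathbb{R}$ cross if there are elements $i<j<k<\ell$ with $i,k$ in one block and $j,\ell$ in the other; a partition is noncrossing if no two of its blocks cross. $M'$ is a flip of $M$ if $M'$ is obtained from $M$ by replacing two pairs $\{i,j\},\{k,\ell\}$ of $M$ by $\{i,\ell\},\{j,k\}$. For real $\epsilon$, $M(\epsilon)$ is the matching in which $i+\epsilon,j+\epsilon$ are matched if and only if $i,j$ are matched in $M$ (addition modulo $2n$). **Necklaces.** A necklace of order $n$ is an $n$-tuple $(M_1,\ldots,M_n)$ of noncrossing matchings on $\langle 0,2n-1\rangle$ such that $M_{s+1}$ is a flip of $M_s$ for $1\le s<n$ and $M_n=M_1(-1)$. **Systems of meanders.** $\Pi_0(M,M')$ is the set of equivalence classes of the equivalence relation on $\langle 0,2n-1\rangle$ generated by $i\sim j$ for every $\{i,j\}\in M$ and for every $\{i,j\}\in M'$. **Strong necklaces.** A pair $\{i,j\}\in M$ is said to cross $\{i',j'\}\in M'$ if the blocks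 $\{i,j\}$ and $\{i'+\frac12,j'+\frac12\}$ of the matching $M\cup M'(\frac12)$ on $\{0,\frac12,1,\ldots,2n-\frac12\}$ cross. An ordered pair $(M,M')$ of noncrossing matchings on $\langle 0,2n-1\rangle$ is a basketball if $M\cup M'(\frac12)$ has exactly $n$ crossings (pairs of crossing blocks). A strong necklace of order $n$ is an $n$-tuple $(M_1,\ldots,M_n)$ of noncrossing matchings on $\langle 0,2n-1\rangle$ such that: (i) $(M_r,M_s)$ is a basketball for all $1\le r<s\le n$; (ii) if $r<s<t$ and $\{i_r,j_r\}\in M_r$ crosses both $\{i_s,j_s\}\in M_s$ and $\{i_t,j_t\}\in M_t$, then $\{i_s,j_s\}\in M_s$ crosses $\{i_t,j_t\}\in M_t$; (iii) $M_{r+1}\ne M_r$ for $1\le r<n$. **Chains.** A partition is $2$-divisible if every block has even cardinality. A maximal chain of $2$-divisible noncrossing partitions on $\langle 0,2n-1\rangle$ is a sequence $(P_1,\ldots,P_n)$ of $2$-divisible noncrossing partitions of $\langle 0,2n-1\rangle$ such that $P_i$ has $n+1-i$ blocks and $P_i$ is a refinement of $P_{i+1}$ for $1\le i<n$. *)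

(* Defs.v *)
From mathcomp Require Import all_boot.
Set Implicit Arguments.
Unset Strict Implicit.
Unset Printing Implicit Defensive.

(* The set <0, 2n-1> is 'I_(n.*2); a family of blocks is an
   element of {set {set 'I_N}}.  An n-tuple (M_1, ..., M_n) is an n.-tuple, so
   that M_s is the item of index s.-1. *)

Definition crossing N (B C : {set 'I_N}) : bool :=
  [exists i : 'I_N, exists j : 'I_N, exists k : 'I_N, exists l : 'I_N,
    [&& i < j, j < k, k < l &
        [&& i \in B, k \in B, j \in C & l \in C] ||
        [&& i \in C, k \in C, j \in B & l \in B]]].

Definition noncrossing N (P : {set {set 'I_N}}) : bool :=
  [forall B in P, forall C in P, (B != C) ==> ~~ crossing B C].

Definition nc_partition N (P : {set {set 'I_N}}) : bool :=
  partition P [set: 'I_N] && noncrossing P.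

Definition matching n (M : {set {set 'I_(n.*2)}}) : bool :=
  [&& partition M [set: 'I_(n.*2)], #|M| == n & [forall B in M, #|B| == 2]].

Definition nc_matching n (M : {set {set 'I_(n.*2)}}) : bool :=
  matching M && noncrossing M.

Definition flip N (M M' : {set {set 'I_N}}) : Prop :=
  exists i j k l : 'I_N,
    [/\ [set i; j] \in M, [set k; l] \in M, [set i; j] != [set k; l]
      & M' = (M :\: [set [set i; j]; [set k; l]])
             :|: [set [set i; l]; [set j; k]]].

Definition relabel (T U : finType) (f : T -> U) (M : {set {set T}}) :
  {set {set U}} := [set f @: (B : {set T}) | B in M].

(* M(-1): ord_pred is i |-> i - 1 modulo N. *)
Definition shift_pred N (M : {set {set 'I_N}}) : {set {set 'I_N}} :=
  relabel (@ord_pred N) M.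

(* The points 0, 1/2, 1, ..., N - 1/2 are encoded, in the same order, by
   'I_(N.*2): the ordinal h stands for h/2, addition of 1/2 modulo N is ordS. *)
Fact at_int_subproof N (i : 'I_N) : i.*2 < N.*2.
Proof. by rewrite ltn_double. Qed.

Definition at_int N (i : 'I_N) : 'I_(N.*2) := Ordinal (at_int_subproof i).

Definition at_half N (i : 'I_N) : 'I_(N.*2) := ordS (at_int i).

(* The matching M \cup M'(1/2). *)
Definition interleave N (M M' : {set {set 'I_N}}) : {set {set 'I_(N.*2)}} :=
  relabel (@at_int N) M :|: relabel (@at_half N) M'.

Definition pair_cross N (B C : {set 'I_N}) : bool :=
  crossing (@at_int N @: B) (@at_half N @: C).

(* Unordered pairs of distinct crossing blocks. *)
Definition crossings N (P : {set {set 'I_N}}) : {set {set {set 'I_N}}} :=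
  [set [set B; C] | B : {set 'I_N} in P, C : {set 'I_N} in P
                  & (B != C) && crossing B C].

Definition basketball n (M M' : {set {set 'I_(n.*2)}}) : Prop :=
  [/\ nc_matching M, nc_matching M' & #|crossings (interleave M M')| = n].

(* The generating relation is symmetric, so its reflexive transitive closure
   [connect] is the equivalence relation it generates. *)
Definition Pi0 N (M M' : {set {set 'I_N}}) : {set {set 'I_N}} :=
  equivalence_partition
    (connect [rel i j : 'I_N | ([set i; j] \in M) || ([set i; j] \in M')])
    [set: 'I_N].

Definition necklace n (M : n.-tuple {set {set 'I_(n.*2)}}) : Prop :=
  [/\ forall s, s < n -> nc_matching (nth set0 M s),
      forall s, s.+1 < n -> flip (nth set0 M s) (nth set0 M s.+1)
    & nth set0 M n.-1 = shift_pred (nth set0 M 0)].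

Definition strong_necklace n (M : n.-tuple {set {set 'I_(n.*2)}}) : Prop :=
  [/\ forall s, s < n -> nc_matching (nth set0 M s),
      forall r s, r < s < n -> basketball (nth set0 M r) (nth set0 M s),
      forall r s t, r < s -> s < t -> t < n ->
        forall Br Bs Bt : {set 'I_(n.*2)},
        Br \in nth set0 M r -> Bs \in nth set0 M s -> Bt \in nth set0 M t ->
        pair_cross Br Bs -> pair_cross Br Bt -> pair_cross Bs Bt
    & forall r, r.+1 < n -> nth set0 M r.+1 <> nth set0 M r].

Definition two_divisible N (P : {set {set 'I_N}}) : bool :=
  [forall B in P, ~~ odd #|B|].

Definition refines N (P Q : {set {set 'I_N}}) : bool :=
  [forall B in P, exists C in Q, B \subset C].

(* With indices starting at 0, the item of index s has n + 1 - (s + 1) blocks. *)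
Definition maximal_chain n (P : n.-tuple {set {set 'I_(n.*2)}}) : Prop :=
  [/\ forall s, s < n ->
        nc_partition (nth set0 P s) && two_divisible (nth set0 P s),
      forall s, s < n -> #|nth set0 P s| = n - s
    & forall s, s.+1 < n -> refines (nth set0 P s) (nth set0 P s.+1)].

Definition chain_of_necklace n (M : n.-tuple {set {set 'I_(n.*2)}}) :
  n.-tuple {set {set 'I_(n.*2)}} :=
  [tuple of map (Pi0 (nth set0 M 0)) M].

(* Main.v *)
(* For a partition [P] coarser than a noncrossing matching [M0], let [bprev P] send a point
   to its cyclic predecessor in its block. A necklace is determined by [M_s] being the image
   of [M0 = M_1] under [bprev P_s], where [P_s = Pi0 M0 M_s]. An induction on arcs shows that
   [M0] and its image connect every block of [P]. Given [P_s], the matching [M_{s-1}] is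
   obtained from [M_s] by a flip, which must take place inside one block because [Pi0 M0 M0]
   has [n] blocks and a flip changes the number of blocks by at most one; by planarity that
   block can be cut along a chord [u v] joining the two arcs, and cutting composes [bprev]
   with the transposition of [u] and [v]. Conversely refining a chain by one step is such a
   cut, and conjugating by a transposition is a flip. For the strong property, the image of
   [B \in M0] in [M_r] crosses the image of [C \in M0] in [M_s] ([r < s]) if and only if
   [B = C]. *)

Require Import Defs.
From mathcomp Require Import all_boot perm zify.

Set Implicit Arguments.
Unset Strict Implicit.
Unset Printing Implicit Defensive.

(** * Cyclic predecessors and interlacing pairs *)

(** For four distinct points this is separation of [z] from [t] by [x] and [y] on the circle. The
    parity form is unchanged by swapping the points of either pair, so neither pair has to be
    ordered. *)
Definition interlace (x y z t : nat) : bool :=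
  (x < z) (+) (y < z) (+) ((x < t) (+) (y < t)).

(* The cyclic predecessor of [x] in [B]: the term [N * (y < x)] ranks the elements below
   [x] above all others. The junk value outside [B] is [x]. *)
Definition cpred N (B : {set 'I_N}) (x : 'I_N) : 'I_N :=
  if x \in B then [arg max_(y > x in B) (y + N * (y < x))] else x.

Lemma cpred_spec N (B : {set 'I_N}) (x : 'I_N) : x \in B ->
  cpred B x \in B /\
  forall z, z \in B -> z + N * (z < x) <= cpred B x + N * (cpred B x < x).
Proof. by rewrite /cpred => xB; rewrite xB; case: arg_maxnP. Qed.

Lemma cpred_in N (B : {set 'I_N}) (x : 'I_N) : x \in B -> cpred B x \in B.
Proof. by case/cpred_spec. Qed.

(* For [u < v] the left side says that [cpred B x] is in [u, v) and the right side that [x]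
   is in (u, v]. Being symmetric in [u] and [v], this form needs no case distinction on
   where the cyclic order wraps around. *)
Lemma cpred_xor N (B : {set 'I_N}) (x u v : 'I_N) :
  x \in B -> u \in B -> v \in B ->
  (cpred B x < u) (+) (cpred B x < v) = (x <= u) (+) (x <= v).
Proof.
move=> xB uB vB; have [_ H] := cpred_spec xB.
have := H _ uB; have := H _ vB; have := H _ xB.
have := ltn_ord x; have := ltn_ord u; have := ltn_ord v.
have := ltn_ord (cpred B x).
by case: (ltnP (cpred B x) x); case: (ltnP u x); case: (ltnP v x); lia.
Qed.

(** The relation of [cpred_xor] characterizes the predecessor: tested at [p] and [q = cpred B x], it
    gives [p < q] if and only if [q < p]. *)
Lemma cpred_uniq N (B : {set 'I_N}) (x p : 'I_N) : x \in B -> p \in B ->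
  (forall u v, u \in B -> v \in B ->
     (p < u) (+) (p < v) = (x <= u) (+) (x <= v)) ->
  cpred B x = p.
Proof.
move=> xB pB H; have qB := cpred_in xB.
apply/val_inj; move: (H _ _ pB qB); rewrite -(cpred_xor xB pB qB) !ltnn /=; lia.
Qed.

Lemma cpred_lt N (B : {set 'I_N}) (x u : 'I_N) : x \in B -> u \in B -> u < x ->
  u <= cpred B x < x.
Proof.
by move=> xB uB ux; have := cpred_xor xB uB xB; have := cpred_spec xB; lia.
Qed.

Lemma cpred_inj N (B : {set 'I_N}) : {in B &, injective (cpred B)}.
Proof.
move=> x y xB yB e; apply/val_inj => /=.
have := cpred_xor xB xB yB; rewrite e (cpred_xor yB xB yB); lia.
Qed.

(** For [u < v] the two parts of [B] are [(u, v]] and its complement. Predecessors change only at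
    the two seams: the successor of [u] in [B] now closes up with [v], and the successor of [v] with
    [u]. *)
Lemma cpred_split N (B : {set 'I_N}) (u v x : 'I_N) :
  u \in B -> v \in B -> u != v -> x \in B ->
  cpred [set y in B | (y <= u) (+) (y <= v) == (x <= u) (+) (x <= v)] x
  = tperm u v (cpred B x).
Proof.
move=> uB vB uv xB; have nuv : (u : nat) <> v by move/val_inj => e; rewrite e eqxx in uv.
have pB := cpred_in xB; have pP := cpred_xor xB uB vB.
have pE a b (aB : a \in B) := @cpred_xor _ B x a b xB aB.
move: pP pE; case: tpermP => [->|->|nu nv] pP pE.
- apply: cpred_uniq; rewrite ?inE ?xB ?vB ?eqxx //=; first by lia.
  move=> a b; rewrite !inE => /andP[aB /eqP ea] /andP[bB /eqP eb].
  by have := pE _ _ aB bB; lia.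
- apply: cpred_uniq; rewrite ?inE ?xB ?uB ?eqxx //=; first by lia.
  move=> a b; rewrite !inE => /andP[aB /eqP ea] /andP[bB /eqP eb].
  by have := pE _ _ aB bB; lia.
- have nu' : (cpred B x : nat) <> u by move/val_inj.
  have nv' : (cpred B x : nat) <> v by move/val_inj.
  apply: cpred_uniq; rewrite ?inE ?xB ?pB ?eqxx //=; first by lia.
  by move=> a b; rewrite !inE => /andP[aB _] /andP[bB _]; apply: pE.
Qed.

(** Disjointness makes points of [B] differ from points of [C]; once each pair is sorted, odd parity
    leaves only the two alternating orders. *)
Lemma crossing_interlace N (B C : {set 'I_N}) (x y z t : 'I_N) :
  x \in B -> y \in B -> z \in C -> t \in C -> [disjoint B & C] ->
  interlace x y z t -> crossing B C.
Proof.
move=> xB yB zC tC dBC I.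
have ne (a b : 'I_N) : a \in B -> b \in C -> (a : nat) <> b.
  by move=> aB bC /val_inj ab; move: (disjointFr dBC aB); rewrite ab bC.
have := ne _ _ xB zC; have := ne _ _ xB tC.
have := ne _ _ yB zC; have := ne _ _ yB tC => yt yz xt xz.
have w (a b c d : 'I_N) : a \in B -> b \in B -> c \in C -> d \in C ->
    (a < c < b) && (b < d) || (c < a < d) && (d < b) -> crossing B C.
  move=> aB bB cC dC; case/orP => /andP[/andP[h1 h2] h3].
    apply/existsP; exists a; apply/existsP; exists c.
    apply/existsP; exists b; apply/existsP; exists d.
    by rewrite h1 h2 h3 aB bB cC dC.
  apply/existsP; exists c; apply/existsP; exists a.
  apply/existsP; exists d; apply/existsP; exists b.
  by rewrite h1 h2 h3 aB bB cC dC orbT.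
rewrite /interlace in I; case: (ltnP x y) => xy; case: (ltnP z t) => zt.
- by apply: (w x y z t) => //; lia.
- by apply: (w x y t z) => //; lia.
- by apply: (w y x z t) => //; lia.
- by apply: (w y x t z) => //; lia.
Qed.

Lemma interlace_crossing N (B C : {set 'I_N}) : crossing B C ->
  exists x y z t : 'I_N,
    [/\ x \in B, y \in B, z \in C, t \in C & interlace x y z t].
Proof.
case/existsP=> i /existsP[j] /existsP[k] /existsP[l] /and4P[ij jk kl].
case/orP=> /and4P[h1 h2 h3 h4].
  by exists i, k, j, l; split => //; rewrite /interlace; lia.
by exists j, l, i, k; split => //; rewrite /interlace; lia.
Qed.

(** * Noncrossing partitions and matchings *)

Lemma mem_pblockT N (P : {set {set 'I_N}}) x :
  partition P [set: 'I_N] -> x \in pblock P x.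
Proof. by move=> pP; rewrite mem_pblock (cover_partition pP). Qed.

Lemma pblock_memT N (P : {set {set 'I_N}}) x :
  partition P [set: 'I_N] -> pblock P x \in P.
Proof. by move=> pP; rewrite pblock_mem // (cover_partition pP). Qed.

Lemma in_pblock N (P : {set {set 'I_N}}) x y : partition P [set: 'I_N] ->
  (y \in pblock P x) = (pblock P x == pblock P y).
Proof.
move=> pP; rewrite eq_pblock ?(partition_trivIset pP) //.
by rewrite (cover_partition pP).
Qed.

Lemma partition_disjoint N (P : {set {set 'I_N}}) x y :
  partition P [set: 'I_N] -> pblock P x <> pblock P y ->
  [disjoint pblock P x & pblock P y].
Proof.
move=> pP /eqP ne; have /trivIsetP := partition_trivIset pP.
by apply=> //; apply: pblock_memT.
Qed.

Lemma nc_interlace N (P : {set {set 'I_N}}) (x y z t : 'I_N) :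
  nc_partition P -> pblock P x = pblock P y -> pblock P z = pblock P t ->
  pblock P x <> pblock P z -> interlace x y z t = false.
Proof.
case/andP=> pP /forall_inP nP xy zt xz; apply/negP => I.
have := nP _ (pblock_memT x pP) => /forall_inP /(_ _ (pblock_memT z pP)).
move/eqP: (xz) => /[swap] /implyP H /H /negP; apply.
apply: (@crossing_interlace _ _ _ x y z t) => //; try exact: mem_pblockT.
- by rewrite xy mem_pblockT.
- by rewrite zt mem_pblockT.
- exact: partition_disjoint.
Qed.

Lemma nc_partitionI N (P : {set {set 'I_N}}) : partition P [set: 'I_N] ->
  (forall x y z t : 'I_N, pblock P x = pblock P y -> pblock P z = pblock P t ->
     pblock P x <> pblock P z -> interlace x y z t = false) ->
  nc_partition P.
Proof.
move=> pP H; rewrite /nc_partition pP; apply/forall_inP => B BP.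
apply/forall_inP => C CP; apply/implyP => BC; apply/negP.
have tP := partition_trivIset pP.
case/interlace_crossing=> x [y] [z] [t] [xB yB zC tC].
rewrite H // ?(def_pblock tP BP xB) ?(def_pblock tP BP yB) //.
  by rewrite (def_pblock tP CP zC) (def_pblock tP CP tC).
by rewrite (def_pblock tP CP zC); apply/eqP.
Qed.

Lemma matching_partition n (M : {set {set 'I_(n.*2)}}) :
  matching M -> partition M [set: 'I_(n.*2)].
Proof. by case/and3P. Qed.

Lemma matching_pair n (M : {set {set 'I_(n.*2)}}) B : matching M -> B \in M ->
  exists a b, a != b /\ B = [set a; b].
Proof. by case/and3P=> _ _ /forall_inP H /H /cards2P [a [b [? ?]]]; exists a, b. Qed.

Lemma matching_mate n (M : {set {set 'I_(n.*2)}}) a : matching M ->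
  exists b, a != b /\ [set a; b] \in M.
Proof.
move=> mM; have pM := matching_partition mM.
have [c [d [cd e]]] := matching_pair mM (pblock_memT a pM).
have := pblock_memT a pM; have := mem_pblockT a pM.
rewrite e !inE => /orP[] /eqP ->; first by exists d.
by exists c; rewrite eq_sym setUC.
Qed.

Lemma matchingI n (M : {set {set 'I_(n.*2)}}) :
  partition M [set: 'I_(n.*2)] -> (forall B, B \in M -> #|B| = 2) -> matching M.
Proof.
move=> pM H; have H' : [forall B in M, #|B| == 2] by apply/forall_inP => B /H ->.
rewrite /matching pM H' andbT /=.
have := card_uniform_partition H pM.
by rewrite cardsT card_ord muln2 => /double_inj e; apply/eqP/esym.
Qed.

Lemma pblock_pair n (M : {set {set 'I_(n.*2)}}) a b : matching M ->
  [set a; b] \in M -> pblock M a = [set a; b] /\ pblock M b = [set a; b].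
Proof.
move=> mM ab; have tM := partition_trivIset (matching_partition mM).
by split; apply: def_pblock; rewrite // !inE eqxx ?orbT.
Qed.

Lemma pair_neq n (M : {set {set 'I_(n.*2)}}) a b : matching M ->
  [set a; b] \in M -> a <> b.
Proof. by case/and3P=> _ _ /forall_inP H /H; rewrite cards2; case: (a =P b). Qed.

Lemma mate_uniq n (M : {set {set 'I_(n.*2)}}) a b c : matching M ->
  [set a; b] \in M -> [set a; c] \in M -> b = c.
Proof.
move=> mM ab ac; have := pair_neq mM ab.
have [e _] := pblock_pair mM ab; have [e' _] := pblock_pair mM ac.
have : b \in [set a; c] by rewrite -e' e !inE eqxx orbT.
by rewrite !inE => /orP[] /eqP -> //.
Qed.

Lemma pair_disjoint n (M : {set {set 'I_(n.*2)}}) a b c d : matching M ->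
  [set a; b] \in M -> [set c; d] \in M -> [set a; b] <> [set c; d] ->
  [/\ c <> a, c <> b, d <> a & d <> b].
Proof.
move=> mM ab cd ne; have [ea eb] := pblock_pair mM ab.
have [ec ed] := pblock_pair mM cd.
by split=> e; apply: ne;
  [rewrite -ea -ec e | rewrite -eb -ec e | rewrite -ea -ed e | rewrite -eb -ed e].
Qed.

Lemma pair_interlace n (M : {set {set 'I_(n.*2)}}) a b c d : nc_matching M ->
  [set a; b] \in M -> [set c; d] \in M -> c <> a -> c <> b ->
  interlace a b c d = false.
Proof.
case/andP=> mM nM ab cd ca cb.
have [e1 e2] := pblock_pair mM ab; have [e3 e4] := pblock_pair mM cd.
apply: (@nc_interlace _ M); rewrite ?e1 ?e2 ?e3 ?e4 //.
  by rewrite /nc_partition (matching_partition mM).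
by move/setP/(_ c); rewrite !inE eqxx /= => /orP[] /eqP.
Qed.

(** * Rotating a matching inside the blocks of a partition *)

Definition bprev N (P : {set {set 'I_N}}) (x : 'I_N) : 'I_N := cpred (pblock P x) x.

Definition brot N (P M : {set {set 'I_N}}) : {set {set 'I_N}} := relabel (bprev P) M.

Lemma relabel_pair (T U : finType) (f : T -> U) (M : {set {set T}}) a b :
  [set a; b] \in M -> [set f a; f b] \in relabel f M.
Proof. by move=> ab; apply/imsetP; exists [set a; b]; rewrite ?imsetU1 ?imset_set1. Qed.

Lemma relabel_pairP n (U : finType) (f : 'I_(n.*2) -> U) M B : matching M ->
  B \in relabel f M ->
  exists a b, [/\ [set a; b] \in M, a != b & B = [set f a; f b]].
Proof.
move=> mM /imsetP[C CM ->]; have [a [b [ab e]]] := matching_pair mM CM.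
by exists a, b; rewrite -e CM ab e imsetU1 imset_set1.
Qed.

Lemma pblock_bprev N (P : {set {set 'I_N}}) x : partition P [set: 'I_N] ->
  pblock P (bprev P x) = pblock P x.
Proof.
move=> pP; apply/esym/eqP; rewrite -in_pblock //; apply: cpred_in.
exact: mem_pblockT.
Qed.

Lemma bprev_inj N (P : {set {set 'I_N}}) : partition P [set: 'I_N] ->
  injective (bprev P).
Proof.
move=> pP x y e; have exy : pblock P x = pblock P y.
  by rewrite -(pblock_bprev x pP) e pblock_bprev.
move: e; rewrite /bprev exy; apply: cpred_inj; last exact: mem_pblockT.
by rewrite -exy mem_pblockT.
Qed.

Lemma bprev_xor N (P : {set {set 'I_N}}) (x u v : 'I_N) : partition P [set: 'I_N] ->
  pblock P x = pblock P u -> pblock P x = pblock P v ->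
  (bprev P x < u) (+) (bprev P x < v) = (x <= u) (+) (x <= v).
Proof.
move=> pP xu xv; apply: cpred_xor; first exact: mem_pblockT.
  by rewrite xu mem_pblockT.
by rewrite xv mem_pblockT.
Qed.

Lemma refines_pair N (M P : {set {set 'I_N}}) a b : partition P [set: 'I_N] ->
  refines M P -> [set a; b] \in M -> pblock P a = pblock P b.
Proof.
move=> pP /forall_inP r /r /existsP[C /andP[CP /subsetP s]].
have tP := partition_trivIset pP.
by rewrite !(def_pblock tP CP) // s // !inE eqxx ?orbT.
Qed.

Lemma refines_pblock N (P Q : {set {set 'I_N}}) x y :
  partition P [set: 'I_N] -> partition Q [set: 'I_N] -> refines P Q ->
  pblock P x = pblock P y -> pblock Q x = pblock Q y.
Proof.
move=> pP pQ /forall_inP r e; have tQ := partition_trivIset pQ.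
have /r /existsP[C /andP[CQ /subsetP s]] := pblock_memT x pP.
by rewrite !(def_pblock tQ CQ) // s ?mem_pblockT // e mem_pblockT.
Qed.

Lemma pair_refines n (M P : {set {set 'I_(n.*2)}}) : matching M ->
  partition P [set: 'I_(n.*2)] ->
  (forall a b, [set a; b] \in M -> pblock P a = pblock P b) -> refines M P.
Proof.
move=> mM pP H; apply/forall_inP => B BM; have [a [b [ab e]]] := matching_pair mM BM.
apply/existsP; exists (pblock P a); rewrite pblock_memT //=.
rewrite e in BM *; apply/subsetP => x; rewrite !inE => /orP[] /eqP ->.
  exact: mem_pblockT.
by rewrite (H _ _ BM) mem_pblockT.
Qed.

Lemma relabel_matching n (f : 'I_(n.*2) -> 'I_(n.*2)) M : injective f ->
  matching M -> matching (relabel f M).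
Proof.
move=> fI mM; apply: matchingI.
  have := imset_partition M [set: 'I_(n.*2)] fI.
  have -> : [set f x | x in [set: 'I_(n.*2)]] = setT.
    by apply/eqP; rewrite eqEcard subsetT card_imset // cardsT leqnn.
  by rewrite (matching_partition mM) => ->.
move=> B /(relabel_pairP mM) [a [b [_ ab ->]]].
by rewrite cards2 (inj_eq fI) ab.
Qed.

Lemma brot_refines n (M P : {set {set 'I_(n.*2)}}) : matching M ->
  partition P [set: 'I_(n.*2)] -> refines M P -> refines (brot P M) P.
Proof.
move=> mM pP r; apply/forall_inP => B.
case/(relabel_pairP mM) => a [b [ab _ ->]]; apply/existsP.
exists (pblock P a); rewrite pblock_memT //=; apply/subsetP => x.
rewrite !inE in_pblock // => /orP[] /eqP ->; rewrite pblock_bprev //.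
by rewrite (refines_pair pP r ab).
Qed.

(** Across two blocks this is noncrossing of [P]. Inside one block [bprev P] preserves the cyclic
    order: [bprev_xor] moves [a] and [b] back with the images of [c] and [d] fixed, then moves [c]
    and [d] back. *)
Lemma brot_interlace n (M P : {set {set 'I_(n.*2)}}) a b c d :
  nc_matching M -> nc_partition P -> refines M P ->
  [set a; b] \in M -> [set c; d] \in M -> [set a; b] <> [set c; d] ->
  interlace (bprev P a) (bprev P b) (bprev P c) (bprev P d) = false.
Proof.
move=> ncM ncP r ab cd ne; have /andP[mM _] := ncM; have /andP[pP _] := ncP.
have eab := refines_pair pP r ab; have ecd := refines_pair pP r cd.
have [eac|nac] := eqVneq (pblock P a) (pblock P c); last first.
  by apply: (nc_interlace ncP); rewrite ?pblock_bprev //; apply/eqP.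
have [ca cb da db] := pair_disjoint mM ab cd ne.
have I := pair_interlace ncM ab cd ca cb.
have h1 := @bprev_xor _ P a (bprev P c) (bprev P d) pP.
have h2 := @bprev_xor _ P b (bprev P c) (bprev P d) pP.
have h3 := @bprev_xor _ P c a b pP.
have h4 := @bprev_xor _ P d a b pP.
rewrite !pblock_bprev // in h1 h2 *.
move: (h1 eac (etrans eac ecd)) (h2 (etrans (esym eab) eac) (etrans (etrans (esym eab) eac) ecd)).
move: (h3 (esym eac) (etrans (esym eac) eab)).
move: (h4 (etrans (esym ecd) (esym eac)) (etrans (etrans (esym ecd) (esym eac)) eab)).
have : (c : nat) <> a by move/val_inj.
have : (c : nat) <> b by move/val_inj.
have : (d : nat) <> a by move/val_inj.
have : (d : nat) <> b by move/val_inj.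
move: I; rewrite /interlace; clear; lia.
Qed.

Lemma brot_nc_matching n (M P : {set {set 'I_(n.*2)}}) :
  nc_matching M -> nc_partition P -> refines M P -> nc_matching (brot P M).
Proof.
move=> ncM ncP r; have /andP[mM _] := ncM; have /andP[pP _] := ncP.
have mR := relabel_matching (bprev_inj pP) mM; have pR := matching_partition mR.
rewrite /nc_matching mR; suff /andP[_ //] : nc_partition (brot P M).
apply: nc_partitionI => // x y z t xy zt xz.
have [a [b [ab _ ex]]] := relabel_pairP mM (pblock_memT x pR).
have [c [d [cd _ ez]]] := relabel_pairP mM (pblock_memT z pR).
have := mem_pblockT x pR; have := mem_pblockT y pR.
have := mem_pblockT z pR; have := mem_pblockT t pR.
rewrite -xy -zt ex ez !inE => ht hz hy hx.
have ne : [set a; b] <> [set c; d].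
  move=> e; apply: xz; rewrite ex ez; have := congr1 (fun S : {set 'I_(n.*2)} => bprev P @: S) e.
  by rewrite !imsetU1 !imset_set1.
have := brot_interlace ncM ncP r ab cd ne; rewrite /interlace.
(* Each of [x], [y], [z], [t] may be either end of its pair; a repeated end makes the parity
   vanish. *)
by case/orP: ht => /eqP ->; case/orP: hz => /eqP ->; case/orP: hy => /eqP ->;
  case/orP: hx => /eqP ->; 
  case: (bprev P a < bprev P c); case: (bprev P b < bprev P c);
  case: (bprev P a < bprev P d); case: (bprev P b < bprev P d).
Qed.

(** Descent on [x + y]: the larger of two distinct elements has a smaller predecessor, since the
    other one lies below it. *)
Lemma cpred_connected N (L : eqType) (f : 'I_N -> L) (B : {set 'I_N}) :
  (forall x, x \in B -> f (cpred B x) = f x) ->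
  forall x y, x \in B -> y \in B -> f x = f y.
Proof.
move=> H; suff key k (x y : 'I_N) : x + y <= k -> x \in B -> y \in B -> f x = f y.
  by move=> x y; apply: (key (x + y)).
elim: k x y => [|k IH] x y xyk xB yB.
  by congr f; apply/val_inj => /=; lia.
case: (ltngtP x y) => [xy|yx|/val_inj -> //].
  rewrite -(H y yB); have := cpred_lt yB xB xy => /andP[_ h].
  by apply: IH; rewrite ?cpred_in //; lia.
rewrite -(H x xB); have := cpred_lt xB yB yx => /andP[_ h].
by apply: IH; rewrite ?cpred_in //; lia.
Qed.

(* Induction on the arcs of [M]: inside an arc [y z], the map [f] is already known to be
   constant on the elements of the block that precede [z]. *)
Lemma brot_connected n (L : eqType) (f : 'I_(n.*2) -> L)
    (M P : {set {set 'I_(n.*2)}}) :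
  nc_matching M -> partition P [set: 'I_(n.*2)] -> refines M P ->
  (forall a b, [set a; b] \in M -> f a = f b) ->
  (forall a b, [set a; b] \in brot P M -> f a = f b) ->
  forall x y, pblock P x = pblock P y -> f x = f y.
Proof.
move=> ncM pP r fM fR; have /andP[mM _] := ncM.
suff bprevE x : f (bprev P x) = f x.
  move=> x y exy; apply: (@cpred_connected _ _ f (pblock P x)).
  - by move=> z; rewrite in_pblock // => /eqP e; rewrite e; apply: bprevE.
  - exact: mem_pblockT.
  - by rewrite exy mem_pblockT.
have key k : forall y z : 'I_(n.*2), y < z -> z - y <= k -> [set y; z] \in M ->
    f (bprev P y) = f y /\ f (bprev P z) = f z.
  elim: k => [|k IH] y z yz yzk yzM; first by lia.
  have eyz := refines_pair pP r yzM.
  have inner m : forall u : 'I_(n.*2), u <= m -> pblock P u = pblock P y ->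
      y <= u < z -> f u = f y.
    elim: m => [|m IHm] u um uy /andP[yu uz].
      by congr f; apply/val_inj => /=; lia.
    have [<- //|/eqP nyu] := eqVneq y u.
    have nyu' : (y : nat) <> u by move/val_inj.
    have [w [_ uwM]] := matching_mate u mM.
    have uy' : u <> y by move=> e; apply: nyu.
    have uz' : u <> z by move=> e; rewrite e ltnn in uz.
    have I := pair_interlace ncM yzM uwM uy' uz'.
    have nuw : (u : nat) <> w by move/val_inj; apply: pair_neq uwM.
    have wy : (w : nat) <> y.
      move/val_inj => e; rewrite e setUC in uwM.
      by apply: uz'; rewrite (mate_uniq mM yzM uwM).
    have wz : (w : nat) <> z.
      move/val_inj => e; rewrite e setUC in uwM; rewrite setUC in yzM.
      by apply: uy'; rewrite (mate_uniq mM yzM uwM).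
    have yu' : y < u by lia.
    have fu : f (bprev P u) = f u.
      (* As [M] is noncrossing, the mate [w] of [u] also lies inside the arc [y z], so the arc of
         [u] and [w] is shorter and [IH] applies. *)
      rewrite /interlace in I; case: (ltnP u w) => uw.
        by case: (IH u w) => //; lia.
      by rewrite setUC in uwM; case: (IH w u) => //; lia.
    have yB : y \in pblock P u by rewrite uy mem_pblockT.
    have /andP[h1 h2] := cpred_lt (mem_pblockT u pP) yB yu'.
    rewrite -fu; apply: IHm; rewrite ?pblock_bprev // /bprev; lia.
  have yB : y \in pblock P z by rewrite -eyz mem_pblockT.
  have h := cpred_lt (mem_pblockT z pP) yB yz.
  have fz : f (bprev P z) = f y by apply: (inner (bprev P z)); rewrite ?pblock_bprev.
  (* The rotated pair carries the label of [bprev P z] to [bprev P y], the only point whose label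
     was still unknown. *)
  by rewrite (fR _ _ (relabel_pair (bprev P) yzM)) fz -(fM _ _ yzM).
have [w [_ xw]] := matching_mate x mM.
have nxw : (x : nat) <> w by move/val_inj; apply: pair_neq xw.
case: (ltnP x w) => h; first by case: (key (w - x) x w).
by rewrite setUC in xw; case: (key (x - w) w x) => //; lia.
Qed.

Lemma Pi0_brot n (M P : {set {set 'I_(n.*2)}}) :
  nc_matching M -> nc_partition P -> refines M P -> Pi0 M (brot P M) = P.
Proof.
move=> ncM ncP r; have /andP[mM _] := ncM; have /andP[pP _] := ncP.
have rR := brot_refines mM pP r.
rewrite /Pi0; set e := [rel i j | _].
have eS : symmetric e by move=> x y; rewrite /e /= ![[set x; y]]setUC.
have cE x y : connect e x y = (pblock P x == pblock P y).
  apply/idP/eqP => [/connectP[p]|].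
    elim: p x => [|z p IH] x /=; first by move=> _ ->.
    case/andP => exz ezp el; rewrite -(IH z) //.
    by case/orP: exz; apply: refines_pair.
  move=> exy.
  (* [brot_connected] is applied with the connected component of a point as its label. *)
  suff fe : forall a b, e a b -> [set z | connect e a z] = [set z | connect e b z].
    have := @brot_connected n _ (fun a => [set z | connect e a z]) M P ncM pP r.
    move=> /(_ _ _ x y exy) H.
    have : y \in [set z | connect e y z] by rewrite inE.
    by rewrite -H ?inE // => a b ab; apply: fe; rewrite /e /= ab ?orbT.
  move=> a b ab; apply/setP => z; rewrite !inE.
  by apply: (same_connect (sym_connect_sym eS)); apply: connect1.
rewrite -[RHS](equivalence_partition_pblock pP).
rewrite /equivalence_partition; apply: eq_in_imset => x _.
by apply/setP => y; rewrite !inE /= cE in_pblock.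
Qed.

(** * Cutting a block along a chord *)

(** The half-open interval [(u, v]] when [u < v], so [u] and [v] themselves fall on opposite sides.
    It is the right side of [cpred_xor]. *)
Definition side N (u v x : 'I_N) : bool := (x <= u) (+) (x <= v).

Definition cut N (P : {set {set 'I_N}}) (u v : 'I_N) : {set {set 'I_N}} :=
  [set x in pblock P u | side u v x]
    |: ([set x in pblock P u | ~~ side u v x] |: (P :\ pblock P u)).

Section Cut.
Variables (N : nat) (P : {set {set 'I_N}}) (u v : 'I_N).
Hypotheses (pP : partition P [set: 'I_N]) (euv : pblock P u = pblock P v)
  (uv : u <> v).

Let B := pblock P u.
Let S b := [set x in B | side u v x == b].

Let nuv : (u : nat) <> v. Proof. by move/val_inj. Qed.

Let uB : u \in B. Proof. exact: mem_pblockT. Qed.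

Let vB : v \in B. Proof. by rewrite /B euv mem_pblockT. Qed.

Let cutE : cut P u v = S true |: (S false |: (P :\ B)).
Proof.
by rewrite /cut /S; congr (_ |: (_ |: _)); apply/setP => x; rewrite !inE ?eqb_id ?eqbF_neg.
Qed.

Let Sneq0 b : S b != set0.
Proof.
apply/set0Pn; exists (if (u < v) (+) b then u else v).
by rewrite inE /side; case: b; case: ifP; rewrite ?uB ?vB /=; lia.
Qed.

Let SD : [disjoint S true & S false].
Proof.
by apply/pred0P => x /=; rewrite !inE; case: (side _ _ _); rewrite ?andbF.
Qed.

Let SU : S true :|: S false = B.
Proof. by apply/setP => x; rewrite !inE; case: (side _ _ _); rewrite ?andbT ?andbF ?orbF. Qed.

Let BP : B \in P. Proof. exact: pblock_memT. Qed.

Lemma cut_partition : partition (cut P u v) [set: 'I_N].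
Proof.
have pD := partitionD1 pP BP; rewrite cutE.
have h1 : [disjoint S false & [set: 'I_N] :\: B].
  by apply/pred0P => x /=; rewrite !inE; case: (x \in B); rewrite ?andbF.
have h2 : [disjoint S true & S false :|: ([set: 'I_N] :\: B)].
  apply/pred0P => x /=; rewrite !inE; case: (x \in B) => //=.
  by case: (side _ _ _); rewrite ?andbF.
have := partitionU1 (partitionU1 pD (Sneq0 false) h1) (Sneq0 true) h2.
by rewrite (setUA (S true)) SU setTD setUCr.
Qed.

Lemma pblock_cut x : pblock (cut P u v) x =
  if pblock P x == B then [set y in B | side u v y == side u v x] else pblock P x.
Proof.
have tC := partition_trivIset cut_partition; case: eqVneq => [e|ne].
  apply: def_pblock => //; last by rewrite inE -e mem_pblockT ?eqxx.
  by rewrite cutE !inE; case: (side u v x); rewrite -/(S _) eqxx ?orbT.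
apply: def_pblock => //; last exact: mem_pblockT.
by rewrite cutE !inE ne pblock_memT ?orbT.
Qed.

Lemma card_cut : #|cut P u v| = #|P|.+1.
Proof.
have SnP b : S b \notin P :\ B.
  rewrite !inE negb_and negbK; apply/orP.
  have /set0Pn[x xS] := Sneq0 b; have := xS; rewrite inE => /andP[xB _].
  have tP := partition_trivIset pP.
  case: (boolP (S b \in P)) => h; last by right.
  by left; rewrite -(def_pblock tP h xS) (def_pblock tP BP xB).
have ST : S true \notin S false |: (P :\ B).
  rewrite in_setU1 negb_or SnP andbT; apply/eqP => e.
  by have := SD; rewrite e -setI_eq0 setIid (negPf (Sneq0 false)).
by rewrite cutE cardsU1 ST cardsU1 SnP [in RHS](cardsD1 B P) BP.
Qed.

Lemma cut_refines : refines (cut P u v) P.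
Proof.
have sS b : S b \subset B by apply/subsetP => x; rewrite inE => /andP[].
apply/forall_inP => C; rewrite cutE !inE => /or3P[/eqP ->|/eqP ->|/andP[_ CP]];
  apply/existsP; [exists B|exists B|exists C]; rewrite ?BP ?sS //.
by rewrite CP subxx.
Qed.

(** In the cut block this is [cpred_split]; in any other block the predecessor stays away from [u]
    and [v]. *)
Lemma bprev_cut x : bprev (cut P u v) x = tperm u v (bprev P x).
Proof.
rewrite /bprev pblock_cut; case: eqVneq => [e|ne].
  rewrite e; apply: cpred_split => //; last by rewrite -e mem_pblockT.
  exact/eqP.
rewrite tpermD //; apply/eqP => e; move/eqP: ne; apply.
  by rewrite -[LHS](pblock_bprev x pP) /bprev -e.
by rewrite -[LHS](pblock_bprev x pP) /bprev -e.
Qed.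

(** Two parts of the cut block are separated by the interval [(u, v]] or its complement, so they
    cannot cross; other crossings would already occur in [P]. *)
Lemma cut_nc : nc_partition P -> nc_partition (cut P u v).
Proof.
move=> ncP; apply: nc_partitionI; first exact: cut_partition.
move=> x y z t; have pC := cut_partition.
move=> xy zt xz; have r := cut_refines.
have xyP := refines_pblock pC pP r xy; have ztP := refines_pblock pC pP r zt.
have [e|ne] := eqVneq (pblock P x) (pblock P z); last first.
  by apply: (nc_interlace ncP) => //; apply/eqP.
have [eB|neB] := eqVneq (pblock P x) B; last first.
  by case: xz; rewrite !pblock_cut -e (negPf neB).
have sd a b : pblock P a = B -> pblock P b = B ->
    (pblock (cut P u v) a == pblock (cut P u v) b) = (side u v b == side u v a).
  by move=> ea eb; rewrite -in_pblock // pblock_cut ea eqxx inE -eb mem_pblockT.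
move/eqP: xz; move/eqP: zt; move/eqP: xy; rewrite !sd -?ztP -?e -?xyP //.
by rewrite /side /interlace; clear; lia.
Qed.

End Cut.

(** * Flips as transpositions, and undoing a flip *)

Lemma relabelK (T : finType) (f : T -> T) : involutive f -> involutive (relabel f).
Proof.
move=> fK M; apply/setP => B; rewrite /relabel -imset_comp.
rewrite (_ : _ @: M = M) //; apply/setP => C.
have E (D : {set T}) : f @: (f @: D) = D.
  by rewrite -imset_comp -[RHS]imset_id; apply: eq_imset => x /=.
apply/imsetP/idP => [[D DM ->]|CM]; first by rewrite /= E.
by exists C; rewrite //= E.
Qed.

(** A flip makes [j] and [l] exchange their mates; the pairs away from both are fixed. *)
Lemma flip_tperm n (M : {set {set 'I_(n.*2)}}) i j k l : matching M ->
  [set i; j] \in M -> [set k; l] \in M -> [set i; j] <> [set k; l] ->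
  (M :\: [set [set i; j]; [set k; l]]) :|: [set [set i; l]; [set j; k]]
  = relabel (tperm j l) M.
Proof.
move=> mM ij kl ne; have [ki kj li lj] := pair_disjoint mM ij kl ne.
have nij := pair_neq mM ij; have nkl := pair_neq mM kl.
have eil : [set i; l] = [set tperm j l i; tperm j l j].
  by rewrite tpermL tpermD //; apply/eqP => // /esym.
have ejk : [set j; k] = [set tperm j l l; tperm j l k].
  by rewrite tpermR tpermD //; apply/eqP => // /esym.
have other B : B \in M -> B != [set i; j] -> B != [set k; l] ->
    tperm j l @: B = B.
  move=> BM Bij Bkl; have [a [b [ab e]]] := matching_pair mM BM; rewrite e in BM Bij Bkl *.
  have [_ ja _ jb] := pair_disjoint mM ij BM (nesym (elimN eqP Bij)).
  have [_ la _ lb] := pair_disjoint mM kl BM (nesym (elimN eqP Bkl)).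
  by rewrite imsetU1 imset_set1 !tpermD //; apply/eqP => /esym.
apply/setP => B; rewrite !inE negb_or; apply/idP/idP.
  case/orP=> [/andP[/andP[Bij Bkl] BM]|/orP[] /eqP ->].
  - by apply/imsetP; exists B; rewrite ?other.
  - by rewrite eil; apply: relabel_pair.
  - by rewrite ejk; apply: relabel_pair; rewrite setUC.
case/imsetP=> C CM ->; have [->|Cij] := eqVneq C [set i; j].
  by rewrite imsetU1 imset_set1 -eil eqxx orbT.
have [->|Ckl] := eqVneq C [set k; l].
  by rewrite imsetU1 imset_set1 setUC -ejk eqxx !orbT.
by rewrite other // Cij Ckl CM.
Qed.

(* Of the two chords [j l] and [i k] joining the flipped arcs, [j l] is the one along which
   [P] can be cut when [j], [k], [l] are in this cyclic order. *)
Lemma unflip_cut n (M0 M1 M2 P : {set {set 'I_(n.*2)}}) i j k l :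
  nc_matching M0 -> nc_matching M1 -> nc_matching M2 ->
  [set i; j] \in M1 -> [set k; l] \in M1 -> [set i; j] <> [set k; l] ->
  M2 = (M1 :\: [set [set i; j]; [set k; l]]) :|: [set [set i; l]; [set j; k]] ->
  nc_partition P -> refines M0 P -> brot P M0 = M2 ->
  pblock P j = pblock P l -> (j < k) (+) (k < l) (+) (l < j) = false ->
  [/\ nc_partition (cut P j l), refines M0 (cut P j l) & brot (cut P j l) M0 = M1].
Proof.
move=> ncM0 ncM1 ncM2 ij kl ne eM2 ncP r eR ejl o.
have /andP[mM0 _] := ncM0; have /andP[mM1 _] := ncM1; have /andP[mM2 _] := ncM2.
have /andP[pP _] := ncP.
have [ki kj li lj] := pair_disjoint mM1 ij kl ne.
have il2 : [set i; l] \in M2 by rewrite eM2 !inE eqxx !orbT.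
have jk2 : [set j; k] \in M2 by rewrite eM2 !inE eqxx !orbT.
have njl : j <> l by move=> e; apply: lj.
have I1 := pair_interlace ncM1 ij kl ki kj.
have nji : j <> i by move=> /esym; apply: pair_neq ij.
have I2 := pair_interlace ncM2 il2 jk2 nji njl.
have d (a b : 'I_(n.*2)) : a <> b -> (a : nat) <> b by move=> h /val_inj.
(* The chord [j l] separates no pair of [M2]. The strict inequalities are those on the left of
   [bprev_xor], so pulling back along [bprev P] gives [side j l] on the pairs of [M0]. *)
have pq_side p q : [set p; q] \in M2 ->
    (p < j) (+) (p < l) = (q < j) (+) (q < l).
  have := d _ _ ki; have := d _ _ kj; have := d _ _ li; have := d _ _ lj.
  have := d _ _ nji; have := d _ _ (pair_neq mM1 kl) => h1 h2 h3 h4 h5 h6 pq.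
  have [e|/eqP ne1] := eqVneq [set p; q] [set i; l].
    have : p \in [set i; l] by rewrite -e !inE eqxx.
    rewrite !inE => /orP[] /eqP ep; rewrite ep in pq *.
      rewrite (mate_uniq mM2 pq il2); move: I1 I2 o.
      by rewrite /interlace; clear -h1 h2 h3 h4 h5 h6; lia.
    have li2 : [set l; i] \in M2 by rewrite setUC.
    rewrite (mate_uniq mM2 pq li2); move: I1 I2 o.
    by rewrite /interlace; clear -h1 h2 h3 h4 h5 h6; lia.
  have [e|/eqP ne2] := eqVneq [set p; q] [set j; k].
    have : p \in [set j; k] by rewrite -e !inE eqxx.
    rewrite !inE => /orP[] /eqP ep; rewrite ep in pq *.
      rewrite (mate_uniq mM2 pq jk2); move: o; clear -h1 h2 h3 h4 h5 h6; lia.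
    have kj2 : [set k; j] \in M2 by rewrite setUC.
    rewrite (mate_uniq mM2 pq kj2); move: o; clear -h1 h2 h3 h4 h5 h6; lia.
  (* A pair untouched by the flip interlaces neither [j k] in [M2] nor [k l] in [M1], and these two
     parities add up to the one for [j l]. *)
  have pq1 : [set p; q] \in M1.
    by move: (pq); rewrite eM2 !inE => /orP[/andP[]//|/orP[/eqP/ne1|/eqP/ne2]].
  have [jp jq kp kq] := pair_disjoint mM2 pq jk2 ne2.
  have := pair_interlace ncM2 pq jk2 jp jq; have := pair_interlace ncM1 pq1 kl kp kq.
  by rewrite /interlace; clear; lia.
have bprevE x : bprev (cut P j l) x = tperm j l (bprev P x) by apply: bprev_cut.
split; first exact: cut_nc.
  apply: pair_refines => // [|a b ab]; first exact: cut_partition.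
  have eab := refines_pair pP r ab.
  rewrite !pblock_cut // eab; case: eqVneq => // e.
  have : [set bprev P a; bprev P b] \in M2 by rewrite -eR; apply: relabel_pair.
  by move/pq_side; rewrite !bprev_xor ?eab ?e // /side => ->.
rewrite -[RHS](relabelK (tpermK j l)) -(flip_tperm mM1 ij kl ne) -eM2 -eR.
by rewrite /brot /relabel -imset_comp; apply: eq_imset => B /=;
  rewrite -imset_comp; apply: eq_imset.
Qed.

(** A set closed under taking mates is a disjoint union of pairs. *)
Lemma matching_card_even n (M : {set {set 'I_(n.*2)}}) (S : {set 'I_(n.*2)}) :
  matching M -> (forall a b, [set a; b] \in M -> a \in S -> b \in S) -> ~~ odd #|S|.
Proof.
move=> mM H; have pM := matching_partition mM; have tM := partition_trivIset pM.
have -> : S = cover [set B in M | B \subset S].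
  apply/setP => x; apply/idP/bigcupP => [xS|[B]]; last first.
    by rewrite inE => /andP[_ /subsetP s] /s.
  have [y [_ xy]] := matching_mate x mM.
  exists [set x; y]; last by rewrite !inE eqxx.
  rewrite inE xy /=; apply/subsetP => z; rewrite !inE => /orP[] /eqP -> //.
  exact: H xy xS.
set Q := [set B in M | _]; have tQ : trivIset Q.
  by apply: trivIsetS tM; apply/subsetP => B; rewrite inE => /andP[].
move: (leq_card_cover Q) => [_]; rewrite tQ => /eqP ->.
rewrite (eq_bigr (fun=> 2)) ?sum_nat_const ?oddM ?andbF // => B.
by rewrite inE => /andP[BM _]; case/and3P: mM => _ _ /forall_inP /(_ _ BM) /eqP.
Qed.

(* If the flip joined two blocks of [P], a labelling constant on the pairs of [M0] and
   [M1] would be constant on the blocks of [P]: within the block of [i], its level set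
   through [i] is a union of pairs of [M0] and, were [l] not in it, would become a union
   of pairs of [M2] on removing [i], contradicting parity. *)
Lemma unflip_same_block n (L : finType) (f : 'I_(n.*2) -> L)
    (M0 M1 M2 P : {set {set 'I_(n.*2)}}) i j k l :
  nc_matching M0 -> nc_matching M1 -> nc_matching M2 ->
  [set i; j] \in M1 -> [set k; l] \in M1 -> [set i; j] <> [set k; l] ->
  M2 = (M1 :\: [set [set i; j]; [set k; l]]) :|: [set [set i; l]; [set j; k]] ->
  nc_partition P -> refines M0 P -> brot P M0 = M2 ->
  (forall a b, [set a; b] \in M0 -> f a = f b) ->
  (forall a b, [set a; b] \in M1 -> f a = f b) ->
  #|P| < #|f @: [set: 'I_(n.*2)]| -> pblock P j = pblock P l.
Proof.
move=> ncM0 ncM1 ncM2 ij kl ne eM2 ncP r eR f0 f1 cf.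
have /andP[mM0 _] := ncM0; have /andP[mM1 _] := ncM1; have /andP[mM2 _] := ncM2.
have /andP[pP _] := ncP.
have il2 : [set i; l] \in M2 by rewrite eM2 !inE eqxx !orbT.
have jk2 : [set j; k] \in M2 by rewrite eM2 !inE eqxx !orbT.
have r2 : refines M2 P by rewrite -eR; apply: brot_refines.
have eil := refines_pair pP r2 il2; have ejk := refines_pair pP r2 jk2.
have [//|/eqP njl] := eqVneq (pblock P j) (pblock P l); exfalso.
have fil : f i = f l.
  have [//|nf] := eqVneq (f i) (f l); exfalso.
  pose S := [set x in pblock P i | f x == f i].
  have iS : i \in S by rewrite inE mem_pblockT ?eqxx.
  have : ~~ odd #|S|.
    apply: (matching_card_even mM0) => a b ab; rewrite !inE !in_pblock //.
    by rewrite (refines_pair pP r ab) (f0 _ _ ab).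
  have : ~~ odd #|S :\ i|.
    apply: (matching_card_even mM2) => a b ab; rewrite !inE !in_pblock //.
    case/and3P=> ai /eqP ea /eqP fa; have eb := refines_pair pP r2 ab.
    have bi : b != i.
      apply/eqP => e; rewrite e setUC in ab; have := mate_uniq mM2 ab il2 => al.
      by move: nf; rewrite -fa al eqxx.
    rewrite bi -eb -ea eqxx /= -fa; apply/eqP/esym/f1.
    move: ab; rewrite eM2 !inE => /orP[/andP[] //|/orP[] /eqP e].
      have : a \in [set i; l] by rewrite -e !inE eqxx.
      rewrite !inE (negPf ai) => /eqP al; by move: nf; rewrite -fa al eqxx.
    have : a \in [set j; k] by rewrite -e !inE eqxx.
    by rewrite !inE => /orP[] /eqP al; case: njl; rewrite -eil ea al.
  by rewrite (cardsD1 i S) iS /= => /negPf ->.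
(* Now [f] is also constant on the pairs of [M2], hence on the blocks of [P] by [brot_connected],
   which allows at most [#|P|] labels. *)
have fjk : f j = f k by rewrite -(f1 _ _ ij) fil (f1 _ _ kl).
have f2 a b : [set a; b] \in M2 -> f a = f b.
  have pair x y : f x = f y -> [set a; b] = [set x; y] -> f a = f b.
    move=> e E; have : a \in [set x; y] by rewrite -E !inE eqxx.
    have : b \in [set x; y] by rewrite -E !inE eqxx orbT.
    by rewrite !inE => /orP[] /eqP -> /orP[] /eqP ->.
  rewrite eM2 !inE => /orP[/andP[_ /f1] //|/orP[] /eqP]; first exact: pair.
  exact: pair.
rewrite -eR in f2; have fP := brot_connected ncM0 pP r f0 f2.
suff : #|f @: [set: 'I_(n.*2)]| <= #|P| by rewrite leqNgt cf.
have iP : (pblock P) @: [set: 'I_(n.*2)] \subset P.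
  by apply/subsetP => _ /imsetP[x _ ->]; apply: pblock_memT.
apply: leq_trans (subset_leq_card iP).
(* [f] factors through the blocks: a block gets the label of a picked element, and the default [f i]
   never serves since blocks are nonempty. *)
have -> : f @: [set: 'I_(n.*2)] =
    (fun B : {set 'I_(n.*2)} => odflt (f i) (omap f [pick x in B]))
      @: ((pblock P) @: [set: 'I_(n.*2)]).
  rewrite -imset_comp; apply: eq_imset => x /=.
  case: pickP => [y|/(_ x)] /=; last by rewrite mem_pblockT.
  by rewrite in_pblock // => /eqP /fP.
exact: leq_imset_card.
Qed.

(** The flip happens inside one block by [unflip_same_block], and that block is then cut along [j l]
    or [i k], whichever has the right orientation. *)
Lemma step_back n (L : finType) (f : 'I_(n.*2) -> L)
    (M0 M1 M2 P : {set {set 'I_(n.*2)}}) :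
  nc_matching M0 -> nc_matching M1 -> nc_matching M2 -> flip M1 M2 ->
  nc_partition P -> refines M0 P -> brot P M0 = M2 ->
  (forall a b, [set a; b] \in M0 -> f a = f b) ->
  (forall a b, [set a; b] \in M1 -> f a = f b) ->
  #|P| < #|f @: [set: 'I_(n.*2)]| ->
  exists Q, [/\ nc_partition Q, refines M0 Q, brot Q M0 = M1, refines Q P
              & #|Q| = #|P|.+1].
Proof.
move=> ncM0 ncM1 ncM2 [i [j [k [l [ij kl /eqP ne eM2]]]]] ncP r eR f0 f1 cf.
have /andP[mM1 _] := ncM1; have /andP[mM2 _] := ncM2; have /andP[pP _] := ncP.
have [ki kj li lj] := pair_disjoint mM1 ij kl ne.
have ejl := unflip_same_block ncM0 ncM1 ncM2 ij kl ne eM2 ncP r eR f0 f1 cf.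
have r2 : refines M2 P by rewrite -eR; have /andP[? _] := ncM0; apply: brot_refines.
have il2 : [set i; l] \in M2 by rewrite eM2 !inE eqxx !orbT.
have jk2 : [set j; k] \in M2 by rewrite eM2 !inE eqxx !orbT.
have eik : pblock P i = pblock P k.
  by rewrite (refines_pair pP r2 il2) -ejl (refines_pair pP r2 jk2).
have njl : j <> l by move=> e; apply: lj.
have nik : i <> k by move=> e; apply: ki.
case o : ((j < k) (+) (k < l) (+) (l < j)); last first.
  have [c1 c2 c3] := unflip_cut ncM0 ncM1 ncM2 ij kl ne eM2 ncP r eR ejl o.
  by exists (cut P j l); split=> //; [apply: cut_refines|apply: card_cut].
have nji : j <> i by move=> /esym; apply: pair_neq ij.
have I1 := pair_interlace ncM1 ij kl ki kj.
have I2 := pair_interlace ncM2 il2 jk2 nji njl.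
rewrite setUC in ij; rewrite [[set k; l]]setUC in kl.
have ne' : [set j; i] <> [set l; k] by rewrite setUC [[set l; k]]setUC.
have eM2' : M2 = (M1 :\: [set [set j; i]; [set l; k]])
    :|: [set [set j; k]; [set i; l]].
  rewrite eM2 [[set j; i]]setUC [[set l; k]]setUC; congr (_ :|: _); exact: setUC.
(* Since neither [i j], [k l] nor [i l], [j k] interlace, the cyclic order is [i j k l] or its
   reverse. Here it is the reverse, which is what the chord [i k] requires. *)
have o' : (i < l) (+) (l < k) (+) (k < i) = false.
  have d (a b : 'I_(n.*2)) : a <> b -> (a : nat) <> b by move=> h /val_inj.
  have := d _ _ ki; have := d _ _ kj; have := d _ _ li; have := d _ _ lj.
  have := d _ _ nji; have := d _ _ (pair_neq mM1 kl).
  by move: I1 I2 o; rewrite /interlace; clear; lia.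
have [c1 c2 c3] := unflip_cut ncM0 ncM1 ncM2 ij kl ne' eM2' ncP r eR eik o'.
by exists (cut P i k); split=> //; [apply: cut_refines|apply: card_cut].
Qed.

(** * From necklaces to chains *)

(** Merging the labels of the two flipped pairs makes the labelling fit [M2] and loses at most one
    label. Labellings stand in for counting connected components. *)
Lemma flip_labelling N (L : finType) (f : 'I_N -> L) (M0 M1 M2 : {set {set 'I_N}}) :
  flip M1 M2 ->
  (forall a b, [set a; b] \in M0 -> f a = f b) ->
  (forall a b, [set a; b] \in M1 -> f a = f b) ->
  exists g : 'I_N -> L,
    [/\ forall a b, [set a; b] \in M0 -> g a = g b,
        forall a b, [set a; b] \in M2 -> g a = g b
      & #|f @: [set: 'I_N]| <= #|g @: [set: 'I_N]|.+1].
Proof.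
case=> i [j [k [l [ij kl _ ->]]]] f0 f1.
pose g x := if f x == f i then f k else f x; exists g; split.
- by move=> a b /f0; rewrite /g => ->.
- move=> a b; have pair x y : g x = g y -> [set a; b] = [set x; y] -> g a = g b.
    move=> e E; have : a \in [set x; y] by rewrite -E !inE eqxx.
    have : b \in [set x; y] by rewrite -E !inE eqxx orbT.
    by rewrite !inE => /orP[] /eqP -> /orP[] /eqP ->.
  rewrite !inE => /orP[/andP[_ /f1]|/orP[] /eqP]; first by rewrite /g => ->.
    by apply: pair; rewrite /g eqxx -(f1 _ _ kl); case: ifP.
  by apply: pair; rewrite /g -(f1 _ _ ij) eqxx; case: ifP.
have s : f @: [set: 'I_N] \subset f i |: g @: [set: 'I_N].
  apply/subsetP => _ /imsetP[x _ ->]; rewrite !inE.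
  have [//|ne] := eqVneq (f x) (f i).
  by apply/imsetP; exists x; rewrite // /g (negPf ne).
by apply: leq_trans (subset_leq_card s) _; rewrite cardsU1; case: (_ \notin _).
Qed.

Lemma pblock_imset N (P : {set {set 'I_N}}) : partition P [set: 'I_N] ->
  pblock P @: [set: 'I_N] = P.
Proof.
move=> pP; apply/setP => B; apply/imsetP/idP => [[x _ ->]|BP]; first exact: pblock_memT.
have /set0Pn[x xB] := partition_neq0 pP BP.
by exists x; rewrite // (def_pblock (partition_trivIset pP) BP xB).
Qed.

Lemma refines_refl N (P : {set {set 'I_N}}) : refines P P.
Proof. by apply/forall_inP => B BP; apply/existsP; exists B; rewrite BP subxx. Qed.

Lemma refines_matching_eq n (M M' : {set {set 'I_(n.*2)}}) :
  matching M -> matching M' -> refines M M' -> M = M'.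
Proof.
case/and3P=> _ /eqP cM /forall_inP M2 /and3P[_ /eqP cM' /forall_inP M2'] r.
apply/eqP; rewrite eqEcard cM cM' leqnn andbT; apply/subsetP => B BM.
have /forall_inP /(_ _ BM) /existsP[C /andP[CM BC]] := r.
suff -> : B = C by [].
by apply/eqP; rewrite eqEcard BC (eqP (M2 _ BM)) (eqP (M2' _ CM)).
Qed.

Lemma brot_id n (M : {set {set 'I_(n.*2)}}) : matching M -> brot M M = M.
Proof.
move=> mM; have pM := matching_partition mM.
apply: refines_matching_eq => //; first exact: relabel_matching (bprev_inj pM) mM.
exact: brot_refines (refines_refl M).
Qed.

Lemma matching_nc_partition n (M : {set {set 'I_(n.*2)}}) :
  nc_matching M -> nc_partition M.
Proof. by case/andP=> /matching_partition pM nM; rewrite /nc_partition pM. Qed.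

Lemma nc_partition1 N : 0 < N -> nc_partition [set [set: 'I_N]].
Proof.
move=> N0; apply/andP; split; last first.
  apply/forall_inP => B /set1P ->; apply/forall_inP => C /set1P ->.
  by rewrite eqxx.
rewrite /partition /cover big_set1 eqxx trivIset1 inE /= eq_sym.
by apply/set0Pn; exists (Ordinal N0).
Qed.

(** This matches the closing condition of a necklace with the one-block end of a chain. *)
Lemma brot_setT N (M : {set {set 'I_N}}) : brot [set [set: 'I_N]] M = shift_pred M.
Proof.
apply: eq_imset => B; apply: eq_imset => x.
rewrite /bprev (@def_pblock _ _ [set: 'I_N]) ?inE ?trivIset1 //.
apply: cpred_uniq; rewrite ?inE // => u v _ _ /=.
have := ltn_ord x; have := ltn_ord u; have := ltn_ord v.
case: (val x) => [|m] hv hu hm.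
  by rewrite add0n modn_small; lia.
have -> : (m.+1 + N).-1 = m + N by lia.
by rewrite modnDr modn_small; lia.
Qed.

(** The [n] pairs of the first matching are [n] labels, and each flip costs at most one. *)
Lemma necklace_labelling n (M : n.-tuple {set {set 'I_(n.*2)}}) s :
  necklace M -> s < n -> exists f : 'I_(n.*2) -> {set 'I_(n.*2)},
    [/\ forall a b, [set a; b] \in nth set0 M 0 -> f a = f b,
        forall a b, [set a; b] \in nth set0 M s -> f a = f b
      & n <= #|f @: [set: 'I_(n.*2)]| + s].
Proof.
move=> [ncM flM _]; elim: s => [|s IH] sn.
  have /andP[mM _] := ncM _ sn; have /and3P[pM /eqP cM _] := mM.
  exists (pblock (nth set0 M 0)).
  have H a b : [set a; b] \in nth set0 M 0 ->
      pblock (nth set0 M 0) a = pblock (nth set0 M 0) b.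
    by case/(pblock_pair mM) => -> ->.
  by split=> //; rewrite pblock_imset // cM addn0.
have [f [f0 f1 cf]] := IH (ltnW sn).
have [g [g0 g1 cg]] := flip_labelling (flM _ sn) f0 f1.
by exists g; split=> //; lia.
Qed.

(** Induction backwards from the last matching, where the one-block partition works, by [step_back].
    [Pi0_brot] then identifies the partition found with [P]. *)
Lemma necklace_structure n (M : n.-tuple {set {set 'I_(n.*2)}}) s :
  necklace M -> s < n ->
  let M0 := nth set0 M 0 in let P := Pi0 M0 (nth set0 M s) in
  [/\ nc_partition P, refines M0 P, brot P M0 = nth set0 M s, #|P| = n - s
    & s.+1 < n -> refines P (Pi0 M0 (nth set0 M s.+1))].
Proof.
move=> nM sn M0; have [ncM flM lM] := nM.
have n0 : 0 < n by apply: leq_ltn_trans sn.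
have nc0 : nc_matching M0 by apply: ncM.
suff [P [ncP r eP cP rP]] : exists P,
  [/\ nc_partition P, refines M0 P, brot P M0 = nth set0 M s, #|P| = n - s
    & s.+1 < n -> refines P (Pi0 M0 (nth set0 M s.+1))].
  have <- : P = Pi0 M0 (nth set0 M s) by rewrite -eP Pi0_brot.
  by split.
move: {2}(n - s.+1) (erefl (n - s.+1)) => k; elim: k s sn => [|k IH] s sn ek.
  have es : s = n.-1 by lia.
  exists [set [set: 'I_(n.*2)]]; split.
  - by apply: nc_partition1; lia.
  - apply/forall_inP => B _; apply/existsP; exists [set: 'I_(n.*2)].
    by rewrite inE eqxx subsetT.
  - by rewrite brot_setT es lM.
  - by rewrite cards1; lia.
  - by lia.
have s1 : s.+1 < n by lia.
have ek1 : n - s.+2 = k by lia.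
have [P [ncP r eP cP _]] := IH s.+1 s1 ek1.
have [f [f0 f1 cf]] := necklace_labelling nM sn.
(* At least [n - s] labels against [n - s.+1] blocks. *)
have lt : #|P| < #|f @: [set: 'I_(n.*2)]| by rewrite cP; lia.
have [Q [ncQ rQ eQ rQP cQ]] :=
  step_back nc0 (ncM _ sn) (ncM _ s1) (flM _ s1) ncP r eP f0 f1 lt.
exists Q; split=> //; first by rewrite cQ cP; lia.
by rewrite -eP Pi0_brot.
Qed.

Lemma refines_two_divisible n (M P : {set {set 'I_(n.*2)}}) : matching M ->
  partition P [set: 'I_(n.*2)] -> refines M P -> two_divisible P.
Proof.
move=> mM pP r; apply/forall_inP => B BP; apply: (matching_card_even mM) => a b ab.
have tP := partition_trivIset pP; have eab := refines_pair pP r ab => aB.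
by rewrite -(def_pblock tP BP aB) eab mem_pblockT.
Qed.

Lemma nth_chain n (M : n.-tuple {set {set 'I_(n.*2)}}) s : s < n ->
  nth set0 (chain_of_necklace M) s = Pi0 (nth set0 M 0) (nth set0 M s).
Proof. by move=> sn; rewrite (nth_map set0) // size_tuple. Qed.

Lemma chain_of_necklace_maximal n (M : n.-tuple {set {set 'I_(n.*2)}}) :
  necklace M -> maximal_chain (chain_of_necklace M).
Proof.
move=> nM; have [ncM _ _] := nM; split=> s sn; rewrite ?nth_chain //.
- have [ncP r _ _ _] := necklace_structure nM sn; rewrite ncP.
  have /andP[pP _] := ncP; apply: refines_two_divisible r => //.
  by have /andP[] := ncM 0 (leq_ltn_trans (leq0n s) sn).
- by have [_ _ _ -> _] := necklace_structure nM sn.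
- by have [_ _ _ _] := necklace_structure nM (ltnW sn); apply.
- exact: ltnW.
Qed.

(** The first partition of the chain is the first matching itself, and each later matching is its
    image under [brot] of the corresponding partition. *)
Lemma chain_of_necklace_inj n (M M' : n.-tuple {set {set 'I_(n.*2)}}) :
  necklace M -> necklace M' ->
  chain_of_necklace M = chain_of_necklace M' -> M = M'.
Proof.
move=> nM nM' e; have [ncM _ _] := nM; have [ncM' _ _] := nM'.
have eP s : s < n -> Pi0 (nth set0 M 0) (nth set0 M s)
    = Pi0 (nth set0 M' 0) (nth set0 M' s).
  by move=> sn; rewrite -!nth_chain // e.
have Pi0_id (Q : {set {set 'I_(n.*2)}}) : nc_matching Q -> Pi0 Q Q = Q.
  move=> ncQ; have /andP[mQ _] := ncQ; rewrite -{2}(brot_id mQ) Pi0_brot //.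
    exact: matching_nc_partition.
  exact: refines_refl.
apply/val_inj/(@eq_from_nth _ set0) => [|s]; rewrite !size_tuple // => sn.
have n0 := leq_ltn_trans (leq0n s) sn.
have e0 : nth set0 M 0 = nth set0 M' 0.
  by rewrite -(Pi0_id _ (ncM _ n0)) -(Pi0_id _ (ncM' _ n0)) eP.
have [_ _ <- _ _] := necklace_structure nM sn.
by have [_ _ <- _ _] := necklace_structure nM' sn; rewrite eP // e0.
Qed.

(** * From chains to necklaces *)

(** The map [g] from blocks of [P] to the blocks of [Q] containing them is onto, and its source has
    just one element too many. *)
Lemma merged_blocks N (P Q : {set {set 'I_N}}) :
  partition P [set: 'I_N] -> partition Q [set: 'I_N] -> refines P Q ->
  #|P| = #|Q|.+1 ->
  exists a b, [/\ pblock Q a = pblock Q b, pblock P a <> pblock P b,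
    forall x, pblock Q x = pblock Q a ->
      pblock P x = pblock P a \/ pblock P x = pblock P b
    & forall x y, pblock Q x = pblock Q y -> pblock Q x <> pblock Q a ->
      pblock P x = pblock P y].
Proof.
move=> pP pQ r cP.
pose g (B : {set 'I_N}) := odflt set0 (omap (pblock Q) [pick x in B]).
have gE x : g (pblock P x) = pblock Q x.
  rewrite /g; case: pickP => [y|/(_ x)] /=; last by rewrite mem_pblockT.
  by rewrite in_pblock // => /eqP /(refines_pblock pP pQ r).
have gPQ (R : {set {set 'I_N}}) :
    (forall x, exists2 y, pblock P y \in R & pblock Q y = pblock Q x) ->
    R \subset P -> g @: R = Q.
  move=> H /subsetP RP; apply/setP => B; apply/imsetP/idP => [[C /RP CP ->]|BQ].
    have /set0Pn[x xC] := partition_neq0 pP CP.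
    by rewrite -(def_pblock (partition_trivIset pP) CP xC) gE pblock_memT.
  have /set0Pn[x xB] := partition_neq0 pQ BQ; have [y yR yx] := H x.
  exists (pblock P y) => //.
  by rewrite gE yx (def_pblock (partition_trivIset pQ) BQ xB).
have /dinjectivePn[A AP [B]] : ~~ dinjectiveb g P.
  apply/negP => /dinjectiveP /card_in_imset; rewrite gPQ ?subxx ?cP //.
    by move/esym/eqP; rewrite eqn_leq ltnn.
  by move=> x; exists x; rewrite ?pblock_memT.
rewrite !inE => /andP[nBA BP] eAB.
have /set0Pn[a aA] := partition_neq0 pP AP.
have /set0Pn[b bB] := partition_neq0 pP BP.
have eA := def_pblock (partition_trivIset pP) AP aA.
have eB := def_pblock (partition_trivIset pP) BP bB.
have eab : pblock Q a = pblock Q b by rewrite -!gE eA eB.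
(* Without [A] the map is still onto, because [B] has the same image, and the cardinalities now
   agree. *)
have inj : {in P :\ A &, injective g}.
  apply/imset_injP; rewrite gPQ ?subsetDl //.
    by move: cP; rewrite (cardsD1 A P) AP add1n => -[->].
  move=> x; have [e|ne] := eqVneq (pblock P x) A.
    exists b; rewrite ?eB ?inE ?nBA //.
    by rewrite -eab; apply: (refines_pblock pP pQ r); rewrite e eA.
  by exists x; rewrite ?inE ?ne ?pblock_memT.
exists a, b; split=> //.
- by rewrite eA eB => e; rewrite e eqxx in nBA.
- move=> x ex; have [e|ne] := eqVneq (pblock P x) A; first by left; rewrite eA.
  right; apply: inj; rewrite ?inE ?ne ?pblock_memT ?eB ?nBA //.
  by rewrite gE ex -eB gE.
move=> x y exy nx; have nA z : pblock Q z <> pblock Q a -> pblock P z != A.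
  by move=> nz; apply/eqP => e; apply: nz; rewrite -gE e -gE eA.
apply: inj; rewrite ?inE ?pblock_memT ?nA //; last by rewrite !gE.
by rewrite -exy.
Qed.

Lemma partition_eq N (P Q : {set {set 'I_N}}) : partition P [set: 'I_N] ->
  partition Q [set: 'I_N] ->
  (forall x y, (pblock P x == pblock P y) = (pblock Q x == pblock Q y)) -> P = Q.
Proof.
move=> pP pQ H; rewrite -(pblock_imset pP) -(pblock_imset pQ).
by apply: eq_imset => x; apply/setP => y; rewrite !in_pblock // H.
Qed.

(** Of the two merged blocks, the one with the larger minimum fills a gap of the other. It is the
    part of the merged block in [(u, v]], with [v] its maximum and [u] the predecessor of its
    minimum in the merged block. *)
Lemma refines_cut N (P Q : {set {set 'I_N}}) :
  nc_partition P -> partition Q [set: 'I_N] -> refines P Q ->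
  #|P| = #|Q|.+1 ->
  exists u v, [/\ u <> v, pblock Q u = pblock Q v & P = cut Q u v].
Proof.
move=> ncP pQ r cP; have /andP[pP _] := ncP.
have [a [b [eab nab inab out]]] := merged_blocks pP pQ r cP.
pose first_of x := [arg min_(y < x in pblock P x) (y : nat)].
have firstP x : pblock P (first_of x) = pblock P x /\
    forall y, pblock P y = pblock P x -> first_of x <= y.
  rewrite /first_of; case: arg_minnP => [|y yx ymin]; first exact: mem_pblockT.
  split; first by move: yx; rewrite in_pblock // => /eqP.
  by move=> z ez; apply: ymin; rewrite -ez mem_pblockT.
wlog ltba : a b eab nab inab out / first_of b < first_of a.
  move=> W; case: (ltngtP (first_of b) (first_of a)) => [lt|lt|/val_inj e].
  - exact: W lt.
  - apply: W lt => //; first exact: nesym.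
      by move=> x; rewrite -eab => /inab [] ->; [right|left].
    by move=> x y; rewrite -eab; apply: out.
  - by case: nab; case: (firstP a) => <- _; case: (firstP b) => <- _; rewrite e.
have [ea amin] := firstP a; have [eb _] := firstP b.
move: (first_of a) (first_of b) ea eb amin ltba => a0 b0 ea eb amin ltba.
have rr x y : pblock P x = pblock P y -> pblock Q x = pblock Q y.
  exact: refines_pblock.
have b0Q : b0 \in pblock Q a0 by rewrite in_pblock // (rr _ _ ea) (rr _ _ eb) eab.
have a0Q := mem_pblockT a0 pQ.
pose u := bprev Q a0.
have /andP[b0u ua0] : b0 <= u < a0 by apply: cpred_lt.
have uQ : pblock Q u = pblock Q a by rewrite pblock_bprev // (rr _ _ ea).
have eu : pblock P u = pblock P b.
  by have [e|//] := inab _ uQ; have := amin _ e; rewrite leqNgt ua0.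
case: (@arg_maxnP _ a0 (mem (pblock P a0)) (@nat_of_ord N)); first exact: mem_pblockT.
move=> v; rewrite inE in_pblock // => /eqP ev vmax.
have vQ : pblock Q v = pblock Q a by rewrite -(rr _ _ ev) (rr _ _ ea).
have uv : u <> v by move=> e; apply: nab; rewrite -eu e -ev ea.
have lt_av : a0 <= v by apply: vmax; rewrite inE mem_pblockT.
have sideE y : pblock Q y = pblock Q a -> side u v y = (pblock P y == pblock P a).
  move=> yQ; rewrite /side; have yQ' : y \in pblock Q a0.
    by rewrite in_pblock // yQ (rr _ _ ea).
  have [e|ne] := eqVneq (pblock P y) (pblock P a).
    have := amin _ e; have : y <= v by apply: vmax; rewrite inE in_pblock // ea e.
    by lia.
  have /eqP eyb : pblock P y == pblock P b by case: (inab _ yQ) ne => ->; rewrite eqxx.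
  have := cpred_xor a0Q yQ' (mem_pblockT a0 pQ); rewrite -/(bprev Q a0) -/u leqnn ua0.
  (* As [b0] lies below [a0], noncrossing keeps [y] out of the range from [a0] to [v]; if [y] is
     below [a0], it is at most [u] by the choice of [u]. *)
  have := @nc_interlace _ P a0 v b0 y ncP ev.
  rewrite ea eb eyb /interlace => /(_ erefl nab).
  have : (y : nat) <> v by move=> /val_inj e; case: nab; rewrite -eyb e -ev ea.
  have : (y : nat) <> a0 by move=> /val_inj e; case: nab; rewrite -eyb e ea.
  by move: b0u ua0 ltba lt_av; clear; lia.
exists u, v; split=> //; first by rewrite uQ vQ.
have euv : pblock Q u = pblock Q v by rewrite uQ vQ.
have pC := cut_partition pQ euv uv.
apply: partition_eq => // x y; rewrite -[in RHS]in_pblock // pblock_cut //.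
rewrite uQ; case: (eqVneq (pblock Q x) (pblock Q a)) => [ex|/eqP nx].
  rewrite inE in_pblock //; have [ey|ney] := eqVneq (pblock Q a) (pblock Q y); last first.
    by apply/negbTE/eqP => /rr e; rewrite -ex e eqxx in ney.
  have /eqP nab' := nab.
  rewrite !sideE //=; case: (inab _ ex) => ->; case: (inab _ (esym ey)) => ->;
    by rewrite ?eqxx ?[pblock P b == _]eq_sym ?(negPf nab').
rewrite in_pblock //; apply/eqP/eqP => [/rr //|e]; exact: out.
Qed.

Lemma flip_of_tperm n (M : {set {set 'I_(n.*2)}}) u v : matching M -> u <> v ->
  [set u; v] \notin M -> flip M (relabel (tperm u v) M).
Proof.
move=> mM uv uvM; have [i [_ ui]] := matching_mate u mM.
have [k [_ vk]] := matching_mate v mM; rewrite setUC in ui; rewrite setUC in vk.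
have ne : [set i; u] <> [set k; v].
  move=> e; have : v \in [set i; u] by rewrite e !inE eqxx orbT.
  rewrite !inE => /orP[] /eqP ev; last by apply: uv.
  by rewrite ev setUC ui in uvM.
exists i, u, k, v; split=> //; first exact/eqP.
by rewrite -(flip_tperm mM ui vk ne).
Qed.

(** Nonempty even blocks have at least two elements each, and [n] of them share [2n] points, so
    equality holds throughout. *)
Lemma even_partition_matching n (P : {set {set 'I_(n.*2)}}) :
  partition P [set: 'I_(n.*2)] -> two_divisible P -> #|P| = n -> matching P.
Proof.
move=> pP /forall_inP eP cP; apply: matchingI => // B BP.
have ge2 C : C \in P -> 2 <= #|C|.
  move=> CP; have := eP _ CP; have := partition_neq0 pP CP.
  by rewrite -card_gt0; case: #|C| => [|[]].
have [_] := leqif_sum (fun C (CP : C \in P) => leqif_geq (ge2 C CP)).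
rewrite -(card_partition pP) sum_nat_const cP cardsT card_ord muln2 eqxx.
by move/esym/forall_inP/(_ _ BP) => h; apply/eqP; rewrite eqn_leq h ge2.
Qed.

Lemma maximal_chain_refines n (P : n.-tuple {set {set 'I_(n.*2)}}) s :
  maximal_chain P -> s < n -> refines (nth set0 P 0) (nth set0 P s).
Proof.
case=> _ _ rP; elim: s => [|s IH] sn; first exact: refines_refl.
apply/forall_inP => B BP.
have /forall_inP /(_ _ BP) /existsP[C /andP[CP BC]] := IH (ltnW sn).
have /forall_inP /(_ _ CP) /existsP[D /andP[DP CD]] := rP _ sn.
by apply/existsP; exists D; rewrite DP (subset_trans BC CD).
Qed.

Lemma chain_of_necklace_surj n (P : n.-tuple {set {set 'I_(n.*2)}}) : 0 < n ->
  maximal_chain P ->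
  exists2 M : n.-tuple {set {set 'I_(n.*2)}},
    necklace M & chain_of_necklace M = P.
Proof.
move=> n0 cP; have [ncP cardP rP] := cP.
pose P0 := nth set0 P 0.
have ncPs s : s < n -> nc_partition (nth set0 P s) by move=> /ncP /andP[].
have mP0 : matching P0.
  have /andP[/andP[pP _] dP] := ncP _ n0.
  by apply: even_partition_matching; rewrite ?cardP ?subn0.
have ncP0 : nc_matching P0 by rewrite /nc_matching mP0; have /andP[] := ncPs _ n0.
have r0 s : s < n -> refines P0 (nth set0 P s) by apply: maximal_chain_refines.
pose M := [tuple of map (fun Q => brot Q P0) P].
have nthM s : s < n -> nth set0 M s = brot (nth set0 P s) P0.
  by move=> sn; rewrite (nth_map set0) // size_tuple.
have M0 : nth set0 M 0 = P0 by rewrite nthM // brot_id.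
exists M.
  split=> [s sn|s sn|].
  - by rewrite nthM //; apply: brot_nc_matching; auto.
  - have sn' := ltnW sn; rewrite !nthM //.
    have /andP[pQ _] := ncPs _ sn; have /andP[pPs _] := ncPs _ sn'.
    have cQ : #|nth set0 P s| = #|nth set0 P s.+1|.+1 by rewrite !cardP //; lia.
    have [u [v [uv euv ePs]]] := refines_cut (ncPs _ sn') pQ (rP _ sn) cQ.
    have -> : brot (nth set0 P s.+1) P0 = relabel (tperm u v) (brot (nth set0 P s) P0).
      rewrite -[LHS](relabelK (tpermK u v)); congr relabel.
      rewrite /brot ePs /relabel -imset_comp; apply: eq_imset => B /=.
      by rewrite -imset_comp; apply: eq_imset => x /=; rewrite bprev_cut.
    have mM : matching (brot (nth set0 P s) P0) by apply: relabel_matching => //; apply: bprev_inj.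
    (* Pairs of the rotated matching stay inside blocks of the finer partition, whereas the cut puts
       [u] and [v] in different blocks. *)
    apply: flip_of_tperm => //; apply/negP => uvM.
    have := refines_pair pPs (brot_refines mP0 pPs (r0 _ sn')) uvM.
    have pC := cut_partition pQ euv uv.
    rewrite ePs => /eqP; rewrite -in_pblock // pblock_cut // eqxx inE /side !leqnn.
    have : (u : nat) <> v by move/val_inj.
    by move=> nuv /andP[_]; lia.
  rewrite M0 nthM; last by lia.
  have /andP[pP _] : nc_partition (nth set0 P n.-1) by apply: ncPs; lia.
  have : #|nth set0 P n.-1| = 1 by rewrite cardP; lia.
  move/eqP/cards1P => [B eB]; rewrite eB -brot_setT.
  by have := cover_partition pP; rewrite eB /cover big_set1 => ->.
apply/val_inj/(@eq_from_nth _ set0) => [|s]; rewrite !size_tuple // => sn.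
by rewrite nth_chain // M0 nthM // Pi0_brot //; auto.
Qed.

(** * Crossings between the matchings of a necklace *)

Lemma crossing_sym N (B C : {set 'I_N}) : crossing B C = crossing C B.
Proof.
by apply: eq_existsb => i; apply: eq_existsb => j; apply: eq_existsb => k;
  apply: eq_existsb => l; rewrite orbC.
Qed.

Lemma val_at_half N (x : 'I_N) : at_half x = x.*2.+1 :> nat.
Proof. by rewrite /= modn_small //; have := ltn_ord x; lia. Qed.

Lemma at_int_inj N : injective (@at_int N).
Proof. by move=> x y /(congr1 val) /= /double_inj /val_inj. Qed.

(** [interlace] with [z] and [t] moved up by one half: [x < z + 1/2] means [x <= z]. *)
Definition interlace_half (x y z t : nat) : bool :=
  (x <= z) (+) (y <= z) (+) ((x <= t) (+) (y <= t)).

Lemma pair_cross_set2 N (a b c d : 'I_N) :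
  pair_cross [set a; b] [set c; d] = interlace_half a b c d.
Proof.
have dbl (x y : nat) : (x.*2 < y.*2.+1) = (x <= y) by rewrite ltnS leq_double.
apply/idP/idP.
  case/interlace_crossing=> x [y] [z] [t].
  case=> /imsetP[x' xB ->] /imsetP[y' yB ->] /imsetP[z' zB ->] /imsetP[t' tB ->].
  rewrite /interlace !val_at_half !dbl; move: xB yB zB tB; rewrite !inE /interlace_half.
  by do 4 (case/orP => /eqP ->);
    case: (a <= c); case: (b <= c); case: (a <= d); case: (b <= d).
move=> I; apply: (@crossing_interlace _ _ _ (at_int a) (at_int b) (at_half c) (at_half d)).
- by rewrite imset_f // !inE eqxx.
- by rewrite imset_f // !inE eqxx orbT.
- by rewrite imset_f // !inE eqxx.
- by rewrite imset_f // !inE eqxx orbT.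
- apply/pred0P => x /=; apply/andP => -[/imsetP[y _ ->] /imsetP[z _]].
  by move/(congr1 (@nat_of_ord _)); rewrite val_at_half /=; lia.
by rewrite /interlace !val_at_half !dbl.
Qed.

(** When all four points share their blocks, undoing [bprev Q] and then [bprev P] by [bprev_xor]
    reduces the left side to [interlace_half a b c d]: a pair interlaces its own half-shift and that
    of no other pair of [M]. Across different blocks, noncrossing of [Q] or of [P] gives parity
    zero. *)
Lemma interlace_half_bprev n (M P Q : {set {set 'I_(n.*2)}}) a b c d :
  nc_matching M -> nc_partition P -> nc_partition Q -> refines M P -> refines P Q ->
  [set a; b] \in M -> [set c; d] \in M ->
  interlace_half (bprev P a) (bprev P b) (bprev Q c) (bprev Q d)
  = ([set a; b] == [set c; d]).
Proof.
move=> ncM ncP ncQ rP rPQ ab cd; have /andP[mM _] := ncM.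
have /andP[pP _] := ncP; have /andP[pQ _] := ncQ.
have eab := refines_pair pP rP ab; have ecd := refines_pair pP rP cd.
have rr x y : pblock P x = pblock P y -> pblock Q x = pblock Q y.
  exact: refines_pblock.
have eaQ : pblock Q (bprev P a) = pblock Q a by apply/rr/pblock_bprev.
have ebQ : pblock Q (bprev P b) = pblock Q a by rewrite (rr _ _ eab); apply/rr/pblock_bprev.
have neq (R : {set {set 'I_(n.*2)}}) (x y : 'I_(n.*2)) : pblock R x <> pblock R y -> (x : nat) <> y.
  by move=> h /val_inj e; apply: h; rewrite e.
have [eQ|/eqP neQ] := eqVneq (pblock Q a) (pblock Q c); last first.
  have -> : ([set a; b] == [set c; d]) = false.
    apply/negbTE/eqP => e; have : a \in [set c; d] by rewrite -e !inE eqxx.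
    rewrite !inE => /orP[] /eqP ea; apply: neQ; rewrite ea //.
    by apply/esym/rr.
  have := @nc_interlace _ Q (bprev P a) (bprev P b) (bprev Q c) (bprev Q d) ncQ.
  rewrite eaQ ebQ !pblock_bprev // => /(_ erefl (rr _ _ ecd) neQ).
  have h x y : pblock Q x = pblock Q a -> pblock Q y = pblock Q c -> (x : nat) <> y.
    by move=> ex ey; apply: (neq Q); rewrite ex ey.
  have ecQ := pblock_bprev c pQ; have edQ := etrans (pblock_bprev d pQ) (esym (rr _ _ ecd)).
  have := h _ _ eaQ ecQ; have := h _ _ eaQ edQ.
  have := h _ _ ebQ ecQ; have := h _ _ ebQ edQ.
  by rewrite /interlace /interlace_half; clear; lia.
have := @bprev_xor _ Q c (bprev P a) (bprev P b) pQ.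
have := @bprev_xor _ Q d (bprev P a) (bprev P b) pQ.
rewrite -(rr _ _ ecd) -eQ eaQ ebQ => /(_ erefl erefl) h1 /(_ erefl erefl) h2.
have [eP|/eqP neP] := eqVneq (pblock P a) (pblock P c); last first.
  have -> : ([set a; b] == [set c; d]) = false.
    apply/negbTE/eqP => e; have : a \in [set c; d] by rewrite -e !inE eqxx.
    by rewrite !inE => /orP[] /eqP ea; apply: neP; rewrite ea.
  have := @nc_interlace _ P (bprev P a) (bprev P b) c d ncP.
  rewrite !pblock_bprev // => /(_ eab ecd neP).
  have h x y : pblock P x = pblock P a -> pblock P y = pblock P c -> (x : nat) <> y.
    by move=> ex ey; apply: (neq P); rewrite ex ey.
  have eaP := pblock_bprev a pP; have ebP := etrans (pblock_bprev b pP) (esym eab).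
  have := h _ _ eaP erefl; have := h _ _ eaP (esym ecd).
  have := h _ _ ebP erefl; have := h _ _ ebP (esym ecd).
  by move: h1 h2; rewrite /interlace /interlace_half; clear; lia.
(* [h1] and [h2] have undone [bprev Q] on [c] and [d]; these relations undo [bprev P] on [a] and
   [b]. *)
have := @bprev_xor _ P a c d pP; have := @bprev_xor _ P b c d pP.
rewrite -eab -ecd eP => /(_ erefl erefl) h3 /(_ erefl erefl) h4.
have d0 (x y : 'I_(n.*2)) : x <> y -> (x : nat) <> y by move=> h /val_inj.
have [e|/eqP ne] := eqVneq [set a; b] [set c; d].
  have := d0 _ _ (pair_neq mM cd).
  have : a \in [set c; d] by rewrite -e !inE eqxx.
  rewrite !inE => /orP[] /eqP ea; rewrite ea in ab h3 h4 *.
    have eb := mate_uniq mM ab cd; rewrite eb in h3 *.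
    by move: h1 h2 h3 h4; rewrite ea eb /interlace_half; clear; lia.
  rewrite setUC in cd; have eb := mate_uniq mM ab cd; rewrite eb in h3 *.
  by move: h1 h2 h3 h4; rewrite ea eb /interlace_half; clear; lia.
have [ca cb da db] := pair_disjoint mM ab cd ne.
have := pair_interlace ncM ab cd ca cb.
have := d0 _ _ ca; have := d0 _ _ cb; have := d0 _ _ da; have := d0 _ _ db.
by move: h1 h2 h3 h4; rewrite /interlace /interlace_half; clear; lia.
Qed.

Lemma pair_cross_brot n (M P Q : {set {set 'I_(n.*2)}}) B C :
  nc_matching M -> nc_partition P -> nc_partition Q -> refines M P -> refines P Q ->
  B \in M -> C \in M ->
  pair_cross (bprev P @: B) (bprev Q @: C) = (B == C).
Proof.
move=> ncM ncP ncQ rP rPQ BM CM; have /andP[mM _] := ncM.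
have [a [b [_ eB]]] := matching_pair mM BM; have [c [d [_ eC]]] := matching_pair mM CM.
rewrite eB eC in BM CM *.
by rewrite !imsetU1 !imset_set1 pair_cross_set2 (interlace_half_bprev ncM ncP ncQ rP rPQ).
Qed.

Lemma embed_crossing N K (f : 'I_N -> 'I_K) (M : {set {set 'I_N}}) B C :
  (forall x y, (f x < f y) = (x < y)) -> noncrossing M ->
  B \in M -> C \in M -> f @: B != f @: C -> ~~ crossing (f @: B) (f @: C).
Proof.
move=> fH nM BM CM ne.
have BC : B != C by apply: contraNneq ne => ->.
have := nM => /forall_inP /(_ _ BM) /forall_inP /(_ _ CM) /implyP /(_ BC).
apply: contraNN.
case/existsP=> i /existsP[j] /existsP[k] /existsP[l] /and4P[].
move=> ij jk kl h.
have [i' [j' [k' [l' [ei ej ek el h']]]]] : exists i' j' k' l',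
    [/\ i = f i', j = f j', k = f k', l = f l' &
      [&& i' \in B, k' \in B, j' \in C & l' \in C] ||
      [&& i' \in C, k' \in C, j' \in B & l' \in B]].
  by case/orP: h => /and4P[/imsetP[x xB ->] /imsetP[y yB ->] /imsetP[z zB ->] /imsetP[t tB ->]];
    exists x, z, y, t; rewrite xB yB zB tB ?orbT.
apply/existsP; exists i'; apply/existsP; exists j'.
apply/existsP; exists k'; apply/existsP; exists l'.
by rewrite -!fH -ei -ej -ek -el ij jk kl h'.
Qed.

(** Each pair [B] of [M] contributes exactly one crossing, that between its two images, collected as
    [g B]. *)
Lemma brot_basketball n (M P Q : {set {set 'I_(n.*2)}}) :
  nc_matching M -> nc_partition P -> nc_partition Q -> refines M P -> refines P Q ->
  refines M Q -> basketball (brot P M) (brot Q M).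
Proof.
move=> ncM ncP ncQ rP rPQ rQ; have /andP[mM _] := ncM.
have /andP[pP _] := ncP; have /andP[pQ _] := ncQ.
have ncR := brot_nc_matching ncM ncP rP; have ncS := brot_nc_matching ncM ncQ rQ.
split=> //; pose g (B : {set 'I_(n.*2)}) :=
  [set @at_int _ @: (bprev P @: B); @at_half _ @: (bprev Q @: B)].
have neIH (B C : {set 'I_(n.*2)}) : B \in M ->
    @at_int _ @: (bprev P @: B) != @at_half _ @: (bprev Q @: C).
  move=> BM; have [a [b [_ eB]]] := matching_pair mM BM.
  apply/eqP => /setP /(_ (at_int (bprev P a))).
  rewrite !imset_f ?eB ?inE ?eqxx // => /esym /imsetP[x _] /(congr1 (@nat_of_ord _)).
  by rewrite val_at_half /=; lia.
have crossE B C : B \in M -> C \in M ->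
    crossing (@at_int _ @: (bprev P @: B)) (@at_half _ @: (bprev Q @: C)) = (B == C).
  exact: pair_cross_brot.
suff -> : crossings (interleave (brot P M) (brot Q M)) = g @: M.
  rewrite card_in_imset; first by case/and3P: mM => _ /eqP.
  move=> B C BM CM e.
  have : @at_int _ @: (bprev P @: B) \in g C by rewrite -e !inE eqxx.
  rewrite !inE (negPf (neIH _ _ BM)) orbF => /eqP /(imset_inj (@at_int_inj _)).
  by move/(imset_inj (bprev_inj pP)).
have inI B : B \in M -> @at_int _ @: (bprev P @: B) \in interleave (brot P M) (brot Q M).
  by move=> BM; rewrite inE; apply/orP; left; apply: imset_f; apply: imset_f.
have inH B : B \in M -> @at_half _ @: (bprev Q @: B) \in interleave (brot P M) (brot Q M).
  by move=> BM; rewrite inE; apply/orP; right; apply: imset_f; apply: imset_f.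
apply/setP => X; apply/imset2P/imsetP => [[B C BI]|[B BM ->]]; last first.
  exists (@at_int _ @: (bprev P @: B)) (@at_half _ @: (bprev Q @: B)) => //; first exact: inI.
  by rewrite inE inH // neIH //= crossE.
rewrite inE => /and3P[CI BC xBC ->].
move: BI CI BC xBC; rewrite !inE.
(* Two blocks from the same copy cannot cross by [embed_crossing]; in the mixed cases [crossE]
   forces the same pair of [M]. *)
case/orP=> /imsetP[_ /imsetP[B' BM ->] ->]; case/orP=> /imsetP[_ /imsetP[C' CM ->] ->] ne x.
- exfalso; apply: (elimN idP _ x); apply: (embed_crossing (M := brot P M)) ne.
  + by move=> ? ? /=; rewrite ltn_double.
  + by have /andP[] := ncR.
  + exact: imset_f.
  + exact: imset_f.
- by exists B' => //; move: x; rewrite crossE // => /eqP ->.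
- exists B' => //; move: x; rewrite crossing_sym crossE // => /eqP ->.
  by rewrite /g setUC.
- exfalso; apply: (elimN idP _ x); apply: (embed_crossing (M := brot Q M)) ne.
  + by move=> ? ?; rewrite !val_at_half ltnS ltn_double.
  + by have /andP[] := ncS.
  + exact: imset_f.
  + exact: imset_f.
Qed.

Lemma necklace_strong n (M : n.-tuple {set {set 'I_(n.*2)}}) :
  necklace M -> strong_necklace M.
Proof.
move=> nM; have [ncM flM _] := nM.
pose P s := Pi0 (nth set0 M 0) (nth set0 M s).
have rP r s : r <= s -> s < n -> refines (P r) (P s).
  elim: s => [|s IH] rs sn; first by case: r rs => // _; apply: refines_refl.
  have [<-|ne] := eqVneq r s.+1; first exact: refines_refl.
  have rs' : r <= s by rewrite -ltnS ltn_neqAle ne.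
  have [_ _ _ _ /(_ sn)] := necklace_structure nM (ltnW sn); rewrite -/(P s) -/(P s.+1).
  move=> /forall_inP h; apply/forall_inP => B BP.
  have /forall_inP /(_ _ BP) /existsP[C /andP[CP BC]] := IH rs' (ltnW sn).
  have /existsP[D /andP[DP CD]] := h _ CP.
  by apply/existsP; exists D; rewrite DP (subset_trans BC CD).
split=> // [r s /andP[rs sn]|r s t rs st tn Br Bs Bt|r rn].
- have [ncPr r0 <- _ _] := necklace_structure nM (ltn_trans rs sn).
  have [ncPs s0 <- _ _] := necklace_structure nM sn.
  apply: brot_basketball => //; first by apply: ncM; lia.
  exact: rP (ltnW rs) sn.
- have sn := ltn_trans st tn; have rn := ltn_trans rs sn.
  have nc0 : nc_matching (nth set0 M 0) by apply: ncM; lia.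
  have [ncPr r0 <- _ _] := necklace_structure nM rn.
  have [ncPs s0 <- _ _] := necklace_structure nM sn.
  have [ncPt t0 <- _ _] := necklace_structure nM tn.
  case/imsetP=> B BM -> /imsetP[C CM ->] /imsetP[D DM ->].
  have rrs := rP _ _ (ltnW rs) sn; have rst := rP _ _ (ltnW st) tn.
  have rrt := rP _ _ (ltnW (ltn_trans rs st)) tn.
  rewrite (pair_cross_brot nc0 ncPr ncPs r0 rrs BM CM).
  rewrite (pair_cross_brot nc0 ncPr ncPt r0 rrt BM DM).
  rewrite (pair_cross_brot nc0 ncPs ncPt s0 rst CM DM).
  (* All three blocks are images of pairs of the first matching, and crossing means equality of
     those pairs. *)
  by move=> /eqP <- /eqP <-.
have [i [j [k [l [ij kl /eqP ne e]]]]] := flM _ rn => eM.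
have /andP[mM _] := ncM _ (ltnW rn).
have [_ _ _ lj] := pair_disjoint mM ij kl ne.
have il : [set i; l] \in nth set0 M r by rewrite -eM e !inE eqxx !orbT.
(* If the flip changed nothing, [i] would have both [j] and [l] as mates. *)
by apply: lj; rewrite (mate_uniq mM ij il).
Qed.

Theorem theorem6p10 (n : nat) (hn : 1 <= n) :
  [/\ forall M : n.-tuple {set {set 'I_(n.*2)}},
        necklace M -> maximal_chain (chain_of_necklace M),
      forall M M' : n.-tuple {set {set 'I_(n.*2)}},
        necklace M -> necklace M' ->
        chain_of_necklace M = chain_of_necklace M' -> M = M'
    & forall P : n.-tuple {set {set 'I_(n.*2)}},
        maximal_chain P ->
        exists2 M : n.-tuple {set {set 'I_(n.*2)}},
          necklace M & chain_of_necklace M = P]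
  /\
  (forall M : n.-tuple {set {set 'I_(n.*2)}},
     necklace M -> strong_necklace M).
Proof.
split; last exact: necklace_strong.
split; first exact: chain_of_necklace_maximal.
  exact: chain_of_necklace_inj.
by move=> P; apply: chain_of_necklace_surj.
Qed.
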